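(* Let $\mathcal{P}\subset(\mathbb{R}_{\ge0})^N$ be an integral polytope of dimension $d$, with multibasic Ehrhart polynomial $L_{\mathcal{P}}$, and let $\mathcal{P}^\circ$ denote the interior of $\mathcal{P}$ relative to its affine hull. Then for every $n\in\mathbb{Z}_{>0}$, \[ L_{\mathcal{P}}([-n]_{q_1},[-n]_{q_2},\dots,[-n]_{q_N})=(-1)^d\,\sigma_{n\mathcal{P}^\circ}\!\left(\frac{1}{q_1},\dots,\frac{1}{q_N}\right). \]
   Context: Let $q_1,\dots,q_N$ be indeterminates; $\mathbf{q}^{\mathbf{a}}=q_1^{a_1}\cdots q_N^{a_N}$ for $\mathbf{a}\in\mathbb{Z}^N$; $\mathbb{Q}(\mathbf{q})=\mathbb{Q}(q_1,\dots,q_N)$. For a bounded set or pointed rational polyhedral cone $S\subset\mathbb{R}^N$, $\sigma_S(\mathbf{q})=\sum_{\mathbf{a}\in S\cap\mathbb{Z}^N}\mathbf{q}^{\mathbf{a}}$, identified (for cones) with the rational function it represents. An integral polytope is a convex polytope with vertices in $\mathbb{Z}^N$; $n\mathcal{P}=\{n\alpha\mid\alpha\in\mathcal{P}\}$, and $n\mathcal{P}^\circ=\{n\alpha\mid\alpha\in\mathcal{P}^\circ\}$. The $q$-integer is $[n]_q=\frac{1-q^n}{1-q}$ for $n\in\mathbb{Z}$. For an integral polytope $\mathcal{P}\subset(\mathbb{R}_{\ge0})^N$ with vertices $\mathbf{v}_i=(v_{i1},\dots,v_{iN})$, $1\le i\le m$, let $\mathcal{C}_i=\{r(\mathbf{x}-\mathbf{v}_i)\mid\mathbf{x}\in\mathcal{P},\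 r\in\mathbb{R}_{\ge0}\}$; the multibasic Ehrhart polynomial is $L_{\mathcal{P}}(x_1,\dots,x_N)=\sum_{i=1}^m\sigma_{\mathcal{C}_i}(\mathbf{q})\prod_{k=1}^N(1+q_kx_k-x_k)^{v_{ik}}\in\mathbb{Q}(\mathbf{q})[x_1,\dots,x_N]$, which satisfies $L_{\mathcal{P}}([n]_{q_1},\dots,[n]_{q_N})=\sigma_{n\mathcal{P}}(\mathbf{q})$ for all $n\in\mathbb{Z}_{>0}$. *)

(* Defs.v *)
From mathcomp Require Import all_boot all_order all_algebra fraction finmap.
From mathcomp Require Import boolp classical_sets functions cardinality fsbigop.
From mathcomp Require Import reals topology convex.
From mathcomp Require Import mpoly.

Set Implicit Arguments.
Unset Strict Implicit.
Unset Printing Implicit Defensive.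

Import GRing.Theory Num.Theory.
Import numFieldTopology.Exports.

Local Open Scope classical_set_scope.
Local Open Scope ring_scope.

Definition convex_hull (R : realType) (N : nat) (A : set 'rV[R]_N) :
  set 'rV[R]_N := smallest (@convex_set R 'rV[R]_N) A.

Definition affine_set (R : realType) (N : nat) (A : set 'rV[R]_N) : Prop :=
  forall (x y : 'rV[R]_N) (t : R), A x -> A y -> A (t *: x + (1 - t) *: y).

Definition affine_hull (R : realType) (N : nat) (A : set 'rV[R]_N) :
  set 'rV[R]_N := smallest (@affine_set R N) A.

(* The direction of the affine hull is the row space of U. *)
Definition has_dim (R : realType) (N : nat) (A : set 'rV[R]_N) (d : nat) :
  Prop :=
  exists (x0 : 'rV[R]_N) (U : 'M[R]_N),
    \rank U = d /\ affine_hull A = [set x | (x - x0 <= U)%MS].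

(* Interior for the topology induced on the affine hull. *)
Definition relint (R : realType) (N : nat) (A : set 'rV[R]_N) :
  set 'rV[R]_N :=
  [set x | affine_hull A x /\ within (affine_hull A) (nbhs x) A].

Definition vertex (R : realType) (N : nat) (P : set 'rV[R]_N) (v : 'rV[R]_N) :
  Prop :=
  P v /\ forall (x y : 'rV[R]_N) (t : R), P x -> P y -> 0 < t < 1 ->
    v = t *: x + (1 - t) *: y -> x = y.

Definition dilate (R : realType) (N : nat) (r : R) (A : set 'rV[R]_N) :
  set 'rV[R]_N := [set r *: x | x in A].

Definition tangent_cone (R : realType) (N : nat) (P : set 'rV[R]_N)
  (v : 'rV[R]_N) : set 'rV[R]_N :=
  [set y | exists (r : R) (x : 'rV[R]_N), [/\ 0 <= r, P x & y = r *: (x - v)]].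

Definition intpt (R : realType) (N : nat) (a : 'rV[int]_N) : 'rV[R]_N :=
  map_mx intr a.

Definition integral_polytope (R : realType) (N : nat) (P : set 'rV[R]_N) :
  Prop :=
  (exists s : seq 'rV[R]_N, P = convex_hull [set` s]) /\
  (forall v : 'rV[R]_N, vertex P v -> exists a : 'rV[int]_N, v = intpt R a).

Notation ratfun N := {fraction {mpoly rat[N]}}.

Definition qvar (N : nat) (k : 'I_N) : ratfun N := tofrac 'X_k.

Definition monom (F : fieldType) (N : nat) (x : 'I_N -> F) (a : 'rV[int]_N) :
  F := \prod_(k < N) x k ^ a 0 k.

Definition qint (F : fieldType) (q : F) (n : int) : F := (1 - q ^ n) / (1 - q).

(* sigma_S(x) for bounded S; the sum of [fsbigop] is 0 by convention when S
   contains infinitely many integer points. *)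
Definition sigma_bounded (R : realType) (N : nat) (S : set 'rV[R]_N)
  (x : 'I_N -> ratfun N) : ratfun N :=
  \sum_(a \in [set a : 'rV[int]_N | S (intpt R a)]) monom x a.

(* Laurent polynomials in q_1, ..., q_N, given by their coefficients. *)
Definition laurent (N : nat) := {fsfun 'rV[int]_N -> rat with 0}.

Definition laurent_val (N : nat) (p : laurent N) : ratfun N :=
  \sum_(a <- finsupp p) ratr (p a) * monom (@qvar N) a.

(* The formal series sum_(a in S) q^a represents f = p / g when its product
   with the Laurent polynomial g, computed coefficientwise, is the Laurent
   polynomial p.  At most one f is represented by a given S (multiply
   crosswise), and a pointed rational cone does represent one. *)
Definition represents (R : realType) (N : nat) (S : set 'rV[R]_N)
  (f : ratfun N) : Prop :=
  exists g p : laurent N,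
    [/\ laurent_val g != 0,
        f = laurent_val p / laurent_val g &
        forall a : 'rV[int]_N,
          \sum_(b <- finsupp g) g b * (intpt R (a - b) \in S)%:R = p a].

Definition sigma_cone (R : realType) (N : nat) (S : set 'rV[R]_N) : ratfun N :=
  xget 0 [set f : ratfun N | represents S f].

(* Meant for P in the nonnegative orthant, where absz (v 0 k) = v 0 k. *)
Definition multibasic_ehrhart (R : realType) (N : nat) (P : set 'rV[R]_N) :
  {mpoly (ratfun N)[N]} :=
  \sum_(v \in [set v : 'rV[int]_N | vertex P (intpt R v)])
    sigma_cone (tangent_cone P (intpt R v)) *:
    \prod_(k < N) (1 + qvar k *: 'X_k - 'X_k) ^+ absz (v 0 k).

(* Main.v *)
(* At x_k = [-n]_{q_k} the factor 1 + q_k x_k - x_k becomes q_k^(-n), so with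
   Q = -nP the claim is that, modulo formal series of value 0 (such as indicators
   invariant under a nonzero integer translation), the sum over the vertices w of
   Q of the indicators of w - K_w, K_w being the tangent cone of Q at w, is
   (-1)^d times the indicator of the relative interior of Q.  This is proved for
   every strictly feasible system E = 0, I >= 0 of integer affine forms.  Both
   sides are additive when a half-space l >= 0 and its opposite l <= 0 are cut
   out, so if the identity holds for (E, I) and (E + l, I), it holds for l :: I as
   soon as it holds for -l :: I.  If I is linearly dependent modulo E, some choice
   of signs is infeasible, where there is nothing to prove.  If I is independent,
   the polyhedron is a simplicial cone times a linear space, and reversing one
   inequality at a time only adds indicators containing a line.  The same
   induction shows that all these cones have rational generating functions. *)

Require Import Defs.
From mathcomp Require Import all_boot all_order all_algebra fraction finmap.
From mathcomp Require Import boolp classical_sets cardinality fsbigop.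
From mathcomp Require Import interval_inference reals topology convex.
From mathcomp Require Import mpoly.
From mathcomp Require Import ring lra zify.

Set Implicit Arguments.
Unset Strict Implicit.
Unset Printing Implicit Defensive.

Import Order.TTheory GRing.Theory Num.Theory.
Import numFieldTopology.Exports.

Local Open Scope classical_set_scope.
Local Open Scope ring_scope.

(** * Formal Laurent series with rational coefficients and the values they represent *)

Section FormalSeries.
Variables (N : nat) (K : fieldType) (phi : {rmorphism rat -> K}) (q : 'I_N -> K).
Hypothesis qvar_neq0 : forall k, q k != 0.
Hypothesis q_indep : forall u : 'rV[int]_N, monom q u = 1 -> u = 0.
Local Notation vec := 'rV[int]_N.
Implicit Types (a b u : vec) (F G : vec -> rat) (f g : K).

Lemma cross_mul (L : fieldType) (x y s t : L) :
  s != 0 -> t != 0 -> t * (x * s) = s * (y * t) -> x = y.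
Proof.
move=> s0 t0; rewrite mulrCA [s * _]mulrCA [s * t]mulrC; apply: mulIf.
by rewrite mulf_neq0.
Qed.

Lemma monom0 : monom q 0 = 1.
Proof. by rewrite /monom big1 // => k _; rewrite mxE expr0z. Qed.

Lemma monomD a b : monom q (a + b) = monom q a * monom q b.
Proof.
rewrite /monom -big_split /=; apply: eq_bigr => k _.
by rewrite mxE expfzDr // qvar_neq0.
Qed.

Lemma monomN a : monom (fun k => (q k)^-1) a = monom q (- a).
Proof. by apply: eq_bigr => k _; rewrite mxE exprz_inv. Qed.

(** A morphism [phi] exists only in characteristic 0, where it coincides with [ratr]; this is what
    makes [ratr] multiplicative. *)
Lemma ratrM : {morph (@ratr K) : x y / x * y}.
Proof. by move=> x y; rewrite -!(fmorph_eq_rat phi) rmorphM. Qed.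

Lemma ratr1 : ratr 1 = 1 :> K. Proof. by rewrite -(fmorph_eq_rat phi) rmorph1. Qed.
Lemma ratrN1 : ratr (-1) = -1 :> K. Proof. by rewrite -(fmorph_eq_rat phi) rmorphN1. Qed.

(* A list of pairs (coefficient, exponent) stands for a Laurent polynomial. *)
Definition lpoly := seq (rat * vec).
Implicit Types r s : lpoly.

Definition lval s : K := \sum_(t <- s) ratr t.1 * monom q t.2.

(** Coefficient at [a] of the product of the Laurent polynomial [s] with the formal series whose
    coefficients are [F]. *)
Definition lact s F a : rat := \sum_(t <- s) t.1 * F (a - t.2).

(** The series 1: [lact r delta] is the coefficient function of [r], with repeated exponents
    merged. *)
Definition delta a : rat := (a == 0)%:R.

Definition lmul s r : lpoly :=
  [seq (x.1 * y.1, x.2 + y.2) | x <- s, y <- r].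

Lemma lval_cat s r : lval (s ++ r) = lval s + lval r.
Proof. exact: big_cat. Qed.

Lemma lact_cat s r F a : lact (s ++ r) F a = lact s F a + lact r F a.
Proof. exact: big_cat. Qed.

Lemma lval1 (c : rat) u : lval [:: (c, u)] = ratr c * monom q u.
Proof. exact: big_seq1. Qed.

Lemma lact1 (c : rat) u F a : lact [:: (c, u)] F a = c * F (a - u).
Proof. exact: big_seq1. Qed.

Lemma lval_mul s r : lval (lmul s r) = lval s * lval r.
Proof.
rewrite /lval big_allpairs_dep big_distrl /=; apply: eq_bigr => x _.
rewrite big_distrr /=; apply: eq_bigr => y _.
by rewrite ratrM monomD mulrACA.
Qed.

Lemma lact_mul s r F a : lact (lmul s r) F a = lact s (lact r F) a.
Proof.
rewrite /lact big_allpairs_dep; apply: eq_bigr => x _.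
by rewrite big_distrr /=; apply: eq_bigr => y _; rewrite mulrA opprD addrA.
Qed.

Lemma lactC s r F a : lact s (lact r F) a = lact r (lact s F) a.
Proof.
rewrite /lact; under eq_bigr => x _ do rewrite big_distrr /=.
rewrite exchange_big /=; apply: eq_bigr => y _.
by rewrite big_distrr /=; apply: eq_bigr => x _; rewrite mulrCA addrAC.
Qed.

Lemma eq_lact s F G : F =1 G -> lact s F =1 lact s G.
Proof. by move=> FG a; apply: eq_bigr => t _; rewrite FG. Qed.

Lemma lact_lin s (c : rat) F G a :
  lact s (fun a => c * F a + G a) a = c * lact s F a + lact s G a.
Proof.
rewrite /lact big_distrr -big_split /=; apply: eq_bigr => t _.
by rewrite mulrDr mulrCA.
Qed.

Definition lcoef s : laurent N :=
  [fsfun a in [fset t.2 | t in s]%fset => lact s delta a | 0].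

Lemma lcoefE s a : lcoef s a = lact s delta a.
Proof.
rewrite fsfun_fun; case: ifP => // /negbT as_.
rewrite /lact big_seq big1 // => t ts; rewrite /delta subr_eq0.
case: eqP => [at2|_]; rewrite ?mulr0 //.
by case/negP: as_; rewrite at2; apply/imfsetP; exists t.
Qed.

(** Collects the terms with equal exponent. The additive map [psi] lets it serve both values in [K]
    and actions on rational series. *)
Lemma lcoef_sum (A : pzRingType) (psi : {additive rat -> A}) (h : vec -> A) s :
  \sum_(t <- s) psi t.1 * h t.2 =
  \sum_(b <- finsupp (lcoef s)) psi (lcoef s b) * h b.
Proof.
set S := [fset t.2 | t in s]%fset.
have sub : (finsupp (lcoef s) `<=` S)%fset by exact: finsupp_sub.
rewrite (big_fset_incl _ sub) => [|b _]; last first.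
  by rewrite memNfinsupp => /eqP ->; rewrite raddf0 mul0r.
under [RHS]eq_bigr => b _ do rewrite lcoefE raddf_sum big_distrl /=.
rewrite exchange_big /= [LHS]big_seq [RHS]big_seq; apply: eq_bigr => t ts.
rewrite (big_fsetD1 t.2) /=; last by apply/imfsetP; exists t.
rewrite /delta subrr eqxx mulr1 big_seq big1 ?addr0 // => b.
by rewrite !inE subr_eq0 => /andP[/negPf -> _]; rewrite mulr0 raddf0 mul0r.
Qed.

Lemma lval_lcoef s :
  lval s = \sum_(b <- finsupp (lcoef s)) ratr (lcoef s b) * monom q b.
Proof.
rewrite /lval; under eq_bigr => t _ do rewrite -(fmorph_eq_rat phi).
rewrite (lcoef_sum phi (monom q)).
by apply: eq_bigr => b _; rewrite -(fmorph_eq_rat phi).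
Qed.

Lemma lact_lcoef s F a :
  \sum_(b <- finsupp (lcoef s)) lcoef s b * F (a - b) = lact s F a.
Proof. by rewrite /lact (lcoef_sum idfun (fun b => F (a - b))). Qed.

Lemma eq_lval s r : lact s delta =1 lact r delta -> lval s = lval r.
Proof.
move=> sr; rewrite !lval_lcoef; suff -> : lcoef s = lcoef r by [].
by apply/fsfunP => a; rewrite !lcoefE.
Qed.

(* Unlike [represents], this applies to arbitrary coefficient functions, not only
   to indicators. *)
Definition rep F f := exists s r,
  [/\ lval s != 0, f * lval s = lval r & lact s F =1 lact r delta].

(** Cross-multiplication: the two denominators act on [F] in either order with the same result, so
    the cross products have equal coefficients and hence equal values. *)
Lemma rep_uniq F f g : rep F f -> rep F g -> f = g.
Proof.
move=> [s [r [s0 sf sF]]] [s' [r' [s'0 s'g s'F]]].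
have : lval (lmul s' r) = lval (lmul s r').
  apply: eq_lval => a; rewrite !lact_mul -(eq_lact s' sF) -(eq_lact s s'F).
  exact: lactC.
rewrite !lval_mul -sf -s'g => e; apply: (@cross_mul K f g _ _ s0 s'0 e).
Qed.

Lemma eq_rep F G f : F =1 G -> rep F f -> rep G f.
Proof.
move=> FG [s [r [s0 sf sF]]]; exists s, r; split => // a.
by rewrite -sF; apply: eq_lact => b; rewrite FG.
Qed.

Lemma rep_lin (c : rat) F G f g :
  rep F f -> rep G g -> rep (fun a => c * F a + G a) (ratr c * f + g).
Proof.
move=> [s [r [s0 sf sF]]] [s' [r' [s'0 s'g s'G]]].
exists (lmul s s'), (lmul [:: (c, 0)] (lmul s' r) ++ lmul s r'); split.
- by rewrite lval_mul mulf_neq0.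
- rewrite lval_cat !lval_mul -sf -s'g lval1 monom0; ring.
move=> a; rewrite lact_cat !lact_mul lact1 subr0 lact_mul.
rewrite -(eq_lact s s'G) -(eq_lact s' sF) [in RHS]lactC -lact_lin.
by apply: eq_lact => b; rewrite lact_lin.
Qed.

Lemma rep0 : rep (fun=> 0) 0.
Proof.
exists [:: (1, 0)], [::]; rewrite lval1 ratr1 monom0 mulr1 oner_eq0 mul0r.
by split=> [||a]; rewrite ?lact1 ?mulr0 // /lval /lact big_nil.
Qed.

Lemma repD F G f g : rep F f -> rep G g -> rep (fun a => F a + G a) (f + g).
Proof.
move=> Ff Gg; have := rep_lin 1 Ff Gg; rewrite ratr1 mul1r.
by apply: eq_rep => a; rewrite mul1r.
Qed.

Lemma repZ (c : rat) F f : rep F f -> rep (fun a => c * F a) (ratr c * f).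
Proof.
move=> Ff; have := rep_lin c Ff rep0; rewrite addr0.
by apply: eq_rep => a; rewrite addr0.
Qed.

Lemma repB F G f g : rep F f -> rep G g -> rep (fun a => F a - G a) (f - g).
Proof.
move=> Ff /(repZ (-1)); rewrite ratrN1 mulN1r => /(repD Ff).
by apply: eq_rep => a; rewrite mulN1r.
Qed.

Lemma rep_sum (I : Type) (W : seq I) (P : pred I) (Fs : I -> vec -> rat)
    (fs : I -> K) :
  (forall i, P i -> rep (Fs i) (fs i)) ->
  rep (fun a => \sum_(i <- W | P i) Fs i a) (\sum_(i <- W | P i) fs i).
Proof.
move=> Ff; elim: W => [|i W IH].
  by rewrite big_nil; apply: eq_rep rep0 => a; rewrite big_nil.
rewrite big_cons; case: ifP => Pi.
  by apply: eq_rep (repD (Ff _ Pi) IH) => a; rewrite big_cons Pi.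
by apply: eq_rep IH => a; rewrite big_cons Pi.
Qed.

Lemma rep_monom u : rep (fun a => (a == u)%:R) (monom q u).
Proof.
exists [:: (1, 0)], [:: (1, u)].
rewrite !lval1 ratr1 monom0 !mul1r mulr1 oner_eq0; split => // a.
by rewrite !lact1 !mul1r subr0 /delta subr_eq0.
Qed.

Lemma rep_shift u F f : rep F f -> rep (fun a => F (a - u)) (monom q u * f).
Proof.
move=> [s [r [s0 sf sF]]]; exists s, (lmul [:: (1, u)] r); split => //.
  by rewrite lval_mul lval1 ratr1 mul1r -mulrA sf.
move=> a; rewrite lact_mul lact1 mul1r -sF.
by apply: eq_bigr => t _; rewrite addrAC.
Qed.

(** The difference is (1 - q^u) F, and 1 - q^u is nonzero, so it can be absorbed into the
    denominator. *)
Lemma rep_diff u F f : u != 0 ->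
  rep (fun a => F a - F (a - u)) f -> exists g, rep F g.
Proof.
move=> u0 [s [r [s0 sf sF]]].
have v0 : lval [:: (1, 0); (-1, u)] != 0.
  rewrite /lval big_cons big_seq1 /= ratr1 ratrN1 mulN1r mul1r monom0.
  by rewrite subr_eq0 eq_sym; apply: contra_neq u0; exact: q_indep.
set t := [:: _; _] in v0; exists (lval r / lval (lmul s t)).
exists (lmul s t), r; split; rewrite ?lval_mul ?mulf_neq0 //.
  by rewrite divfK // mulf_neq0.
move=> a; rewrite lact_mul -sF; apply: eq_lact => b.
by rewrite /lact big_cons big_seq1 /= mul1r mulN1r subr0.
Qed.

(** A value g exists by [rep_diff]; the shift by u multiplies it by q^u but leaves [F] unchanged, so
    g = q^u g with q^u different from 1. This is how sets containing an integer direction drop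
    out. *)
Lemma rep_invariant u F : u != 0 -> (forall a, F (a - u) = F a) -> rep F 0.
Proof.
move=> u0 uF; have [|g Fg] := @rep_diff u F 0 u0.
  by apply: eq_rep rep0 => a; rewrite uF subrr.
have /(rep_uniq Fg) : rep F (monom q u * g).
  by apply: eq_rep (rep_shift u Fg).
move/eqP; rewrite -subr_eq0 -{1}[g]mul1r -mulrBl mulf_eq0 subr_eq0.
case/orP => /eqP; last by move=> g0; rewrite g0 in Fg.
by move/esym/q_indep/eqP; rewrite (negPf u0).
Qed.

End FormalSeries.

(** * The field of rational functions as an instance, and the link with [represents] *)

Section RatFun.
Variable N : nat.
Local Notation K := (ratfun N).
Local Notation q := (@qvar N).

Lemma mpolyX_neq0 (m : 'X_{1..N}) : 'X_[m] != 0 :> {mpoly rat[N]}.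
Proof.
apply/eqP => /(congr1 (fun p => p@_m)) /eqP.
by rewrite mcoeffX eqxx mcoeff0 oner_eq0.
Qed.

Lemma qvar_neq0 k : q k != 0.
Proof. by rewrite /qvar tofrac_eq0 mpolyX_neq0. Qed.

Lemma monom_nat (m : 'X_{1..N}) :
  monom q (\row_k (m k)%:Z) = tofrac ('X_[m] : {mpoly rat[N]}).
Proof.
rewrite mpolyXE_id rmorph_prod; apply: eq_bigr => k _.
by rewrite mxE rmorphXn.
Qed.

(** Moving the negative exponents to the other side gives an equality of two polynomial
    monomials. *)
Lemma monom_eq1 (u : 'rV[int]_N) : monom q u = 1 -> u = 0.
Proof.
move=> u1.
pose pos : 'X_{1..N} :=
  [multinom (if (0 <= u 0%R k)%R then absz (u 0%R k) else 0%N) | k < N].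
pose neg : 'X_{1..N} :=
  [multinom (if (0 <= u 0%R k)%R then 0%N else absz (u 0%R k)) | k < N].
have uE : \row_k (pos k)%:Z = u + \row_k (neg k)%:Z.
  apply/rowP => k; rewrite !mxE !mnmE.
  by case: lerP => h; [rewrite gez0_abs // addr0 | rewrite ltz0_abs // subrr].
have /eqP : tofrac ('X_[pos] : {mpoly rat[N]}) = tofrac 'X_[neg].
  by rewrite -!monom_nat uE (monomD qvar_neq0) u1 mul1r.
rewrite tofrac_eq => /eqP /(congr1 (fun p => p@_neg)) /eqP.
rewrite !mcoeffX eqxx; have [pn _|_] := eqVneq pos neg; last by rewrite eq_sym oner_eq0.
by move: uE; rewrite pn -[LHS]add0r => /addIr ->.
Qed.

Definition rat_ratfun : {rmorphism rat -> K} := @tofrac _ \o @mpolyC N rat.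

End RatFun.

(** Lists and finitely supported functions are translated into each other by listing the support and
    by [lcoef]; values and actions are preserved. *)
Lemma represents_rep (R : realType) (N : nat) (S : set 'rV[R]_N) (f : ratfun N) :
  represents S f <-> rep (@qvar N) (fun a => (intpt R a \in S)%:R) f.
Proof.
split=> [[g [p [g0 -> gp]]]|[s [r [s0 sf sF]]]].
  have lvalE (h : laurent N) :
      lval (@qvar N) [seq (h b, b) | b <- finsupp h] = laurent_val h.
    by rewrite /lval big_map.
  exists [seq (g b, b) | b <- finsupp g], [seq (p b, b) | b <- finsupp p].
  rewrite !lvalE divfK //; split=> // a; rewrite /lact !big_map gp /=.
  have [pa|pa] := finsuppP p a.
    rewrite big_seq big1 // => b pb; rewrite /delta subr_eq0.
    by have [ab|_] := eqVneq a b; [rewrite ab pb in pa | rewrite mulr0].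
  rewrite (big_fsetD1 a) //= /delta subrr eqxx mulr1 big_seq big1 ?addr0 // => b.
  by rewrite !inE subr_eq0 eq_sym => /andP[/negPf -> _]; rewrite mulr0.
have lvalE (t : lpoly N) : laurent_val (lcoef t) = lval (@qvar N) t.
  by rewrite (lval_lcoef (rat_ratfun N)).
exists (lcoef s), (lcoef r); rewrite !lvalE -sf; split; first exact: s0.
  exact: (esym (mulfK s0 f)).
by move=> a; rewrite lcoefE -sF -lact_lcoef.
Qed.

(** [sigma_cone] defaults to 0 when nothing is represented, so some value must be known to exist
    first. *)
Lemma rep_sigma_cone (R : realType) (N : nat) (S : set 'rV[R]_N) (f : ratfun N) :
  rep (@qvar N) (fun a => (intpt R a \in S)%:R) f ->
  rep (@qvar N) (fun a => (intpt R a \in S)%:R) (sigma_cone S).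
Proof.
move=> Sf; apply/represents_rep.
by apply: (@xgetPex _ 0 [set f | represents S f]); exists f; apply/represents_rep.
Qed.

(** * Integer affine forms and rational linear algebra on their linear parts *)

Section Forms.
Variable N : nat.

(** The pair (c, k) stands for the affine form c.x + k. *)
Definition form := ('rV[int]_N * int)%type.

Definition rowq (c : 'rV[int]_N) : 'rV[rat]_N := map_mx intr c.

(** Taken over the rationals, so that kernel vectors can be scaled to integer vectors. *)
Definition lspan (L : seq form) : 'M[rat]_N := (\sum_(l <- L) <<rowq l.1>>)%MS.

Definition idot (c u : 'rV[int]_N) : int := \sum_k c 0 k * u 0 k.

Lemma lspan_cons l L : (lspan (l :: L) :=: rowq l.1 + lspan L)%MS.
Proof.
rewrite /lspan big_cons; apply: adds_eqmx (genmxE _) _; exact: eqmx_refl.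
Qed.

Lemma perm_lspan L L' : perm_eq L L' -> lspan L = lspan L'.
Proof. by move=> LL'; apply: perm_big. Qed.

Lemma lspan_mid E l I : lspan (E ++ l :: I) = lspan (l :: E ++ I).
Proof. exact: perm_lspan (permEl (perm_catCA E [:: l] I)). Qed.

Lemma lspan_subP n (M : 'M[rat]_(n, N)) L :
  reflect {in L, forall l, (rowq l.1 <= M)%MS} (lspan L <= M)%MS.
Proof.
elim: L => [|l L IH]; first by rewrite /lspan big_nil sub0mx; constructor.
rewrite lspan_cons addsmx_sub.
apply: (iffP andP) => [[lM /IH LM] l'|LM].
  by rewrite inE => /predU1P[->|/LM].
by split; [|apply/IH => l' L']; apply: LM; rewrite inE ?eqxx // L' orbT.
Qed.

Lemma mem_lspan L l : l \in L -> (rowq l.1 <= lspan L)%MS.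
Proof. by apply/lspan_subP. Qed.

Lemma lspanS L L' : {subset L <= L'} -> (lspan L <= lspan L')%MS.
Proof. by move=> LL'; apply/lspan_subP => l /LL'/mem_lspan. Qed.

Lemma rank_lspan_cons l L : ~~ (rowq l.1 <= lspan L)%MS ->
  \rank (lspan (l :: L)) = (\rank (lspan L)).+1.
Proof.
move=> lL; apply/eqP; rewrite eqn_leq lspan_cons; apply/andP; split.
  by rewrite (leq_trans (mxrank_adds_leqif _ _).1) // rank_rV; case: eqP; rewrite ?leqnSn.
by apply: rank_ltmx; rewrite ltmxE addsmxSr /= addsmx_sub negb_and lL.
Qed.

Lemma rank_lspan_cons_in l L : (rowq l.1 <= lspan L)%MS ->
  \rank (lspan (l :: L)) = \rank (lspan L).
Proof. by move/addsmx_idPr => lL; rewrite lspan_cons lL. Qed.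

Lemma rank_lspan_cat E I : (\rank (lspan (E ++ I)) <= \rank (lspan E) + size I)%N.
Proof.
elim: I => [|l I IH]; first by rewrite cats0 addn0.
rewrite lspan_mid addnS.
have [lEI|/rank_lspan_cons -> //] := boolP (rowq l.1 <= lspan (E ++ I))%MS.
by rewrite rank_lspan_cons_in // (leq_trans IH).
Qed.

(** Linear independence of [I] modulo the span of [E]; the list [E] itself may be dependent. *)
Definition indep E I : bool := \rank (lspan (E ++ I)) == (\rank (lspan E) + size I)%N.

Lemma perm_indep E I I' : perm_eq I I' -> indep E I = indep E I'.
Proof.
by move=> II'; rewrite /indep (perm_size II') (@perm_lspan _ (E ++ I')) ?perm_cat2l.
Qed.

Lemma indep_notin E l I : indep E (l :: I) -> ~~ (rowq l.1 <= lspan (E ++ I))%MS.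
Proof.
rewrite /indep lspan_mid => ind.
apply/negP => /rank_lspan_cons_in lEI; move: (rank_lspan_cat E I).
by rewrite -lEI (eqP ind) addnS ltnn.
Qed.

Lemma indep_behead E l I : indep E (l :: I) -> indep E I.
Proof.
move=> ind; move: (ind) (indep_notin ind) => {ind}.
rewrite /indep lspan_mid => + lEI.
by rewrite rank_lspan_cons // addnS eqSS.
Qed.

(** Only the linear part of [l'] is prescribed, so that it can be any parallel slice l =
    constant. *)
Lemma indep_move E l l' I : l'.1 = l.1 -> indep E (l :: I) -> indep (l' :: E) I.
Proof.
move=> ll' ind; have lEI := indep_notin ind; move: ind.
have lE : ~~ (rowq l.1 <= lspan E)%MS.
  by apply: contra lEI => /submx_trans; apply; apply: lspanS => x; rewrite mem_cat => ->.
rewrite /indep lspan_mid.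
by rewrite !rank_lspan_cons ?ll' //= addnS addSn.
Qed.

Lemma Nindep E I : ~~ indep E I ->
  exists l I', perm_eq I (l :: I') /\ (rowq l.1 <= lspan (E ++ I'))%MS.
Proof.
elim: I => [|l I IH] ind; first by rewrite /indep cats0 addn0 eqxx in ind.
have [lEI|lEI] := boolP (rowq l.1 <= lspan (E ++ I))%MS.
  by exists l, I; split.
case: IH => [|l' [I' [II' l'I]]].
  apply: contra ind; rewrite /indep.
  rewrite lspan_mid.
  by rewrite (rank_lspan_cons lEI) addnS eqSS.
exists l', (l :: I'); split.
  apply: (perm_trans _ (permEl (perm_catCA [:: l] [:: l'] I'))).
  by rewrite perm_cons.
apply: submx_trans l'I _; apply: lspanS => x.
by rewrite !mem_cat inE => /orP[->//|->]; rewrite !orbT.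
Qed.

Lemma denominators (w : 'I_N -> rat) :
  exists D : int, D > 0 /\ exists u : 'I_N -> int, forall k, (u k)%:~R = D%:~R * w k.
Proof.
exists (\prod_k denq (w k)); split; first by apply: prodr_gt0 => k _; exact: denq_gt0.
exists (fun k => numq (w k) * \prod_(j | j != k) denq (w j)) => k.
rewrite [in RHS](bigD1 k) //= !rmorphM /= numqE.
ring.
Qed.

(** Take a column of the cokernel of the span on which [c] is nonzero, clear denominators and adjust
    the sign. *)
Lemma separate (c : 'rV[int]_N) L : ~~ (rowq c <= lspan L)%MS ->
  exists u : 'rV[int]_N, {in L, forall l, idot l.1 u = 0} /\ 0 < idot c u.
Proof.
rewrite submxE => /matrix0Pn[i [j]]; rewrite ord1 {i}.
set C := cokermx _ => cj.
have [D [D0 [u uE]]] := denominators (fun k => C k j).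
have dotE c' : (idot c' (\row_k u k))%:~R = D%:~R * (rowq c' *m C) 0 j.
  rewrite rmorph_sum mxE big_distrr /=; apply: eq_bigr => k _.
  by rewrite [(\row__ _) _ _]mxE rmorphM /= uE mulrCA [rowq _ _ _]mxE.
have dot0 l : l \in L -> idot l.1 (\row_k u k) = 0.
  move=> /mem_lspan; rewrite submxE => /eqP lC.
  by apply/eqP; rewrite -(intr_eq0 rat) dotE lC mxE mulr0.
have dotc : idot c (\row_k u k) != 0.
  by rewrite -(intr_eq0 rat) dotE mulf_neq0 // intr_eq0 gt_eqF.
have [cu|cu] := ltrP 0 (idot c (\row_k u k)); first by exists (\row_k u k).
have dotN c' : idot c' (- \row_k u k) = - idot c' (\row_k u k).
  by rewrite /idot -sumrN; apply: eq_bigr => k _; rewrite !mxE mulrN.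
exists (- \row_k u k); split=> [l /dot0|]; rewrite dotN; first by move->; rewrite oppr0.
by rewrite oppr_gt0 lt_neqAle dotc.
Qed.

(** Some coordinate form lies outside the span, and [separate] applies to it. *)
Lemma integer_kernel L : (\rank (lspan L) < N)%N ->
  exists u : 'rV[int]_N, u != 0 /\ {in L, forall l, idot l.1 u = 0}.
Proof.
move=> rL; have [/forallP sub|] := boolP [forall k, (rowq (delta_mx 0 k) <= lspan L)%MS].
  have : (1%:M <= lspan L)%MS.
    apply/row_subP => k; have := sub k.
    rewrite /rowq map_delta_mx row1 //.
  by rewrite sub1mx /row_full ltn_eqF.
rewrite negb_forall => /existsP[k /separate[u [uL cu]]].
exists u; split=> //; apply: contraTneq cu => ->.
by rewrite /idot big1 // => j _; rewrite [X in _ * X]mxE mulr0.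
Qed.

End Forms.

(** * Forms evaluated at real points, and the sign-flipping induction *)

Section RealForms.
Variables (R : realType) (N : nat).
Local Notation vec := 'rV[R]_N.
Local Notation form := (form N).
Implicit Types (x y w : vec) (l : form) (E I L : seq form).

Definition dot (c : 'rV[int]_N) x : R := \sum_k (c 0 k)%:~R * x 0 k.

Definition ev l x : R := dot l.1 x + l.2%:~R.

Lemma dotDr c x y : dot c (x + y) = dot c x + dot c y.
Proof. by rewrite /dot -big_split; apply: eq_bigr => k _; rewrite mxE mulrDr. Qed.

Lemma dotZr c (t : R) x : dot c (t *: x) = t * dot c x.
Proof. by rewrite /dot big_distrr; apply: eq_bigr => k _; rewrite mxE mulrCA. Qed.

Lemma dotNr c x : dot c (- x) = - dot c x.
Proof. by rewrite -scaleN1r dotZr mulN1r. Qed.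

Lemma dotBr c x y : dot c (x - y) = dot c x - dot c y.
Proof. by rewrite dotDr dotNr. Qed.

Lemma dotr0 c : dot c 0 = 0.
Proof. by rewrite -(scale0r 0) dotZr mul0r. Qed.

Lemma dotNl c x : dot (- c) x = - dot c x.
Proof. by rewrite /dot -sumrN; apply: eq_bigr => k _; rewrite mxE mulrNz mulNr. Qed.

Lemma dotDl c c' x : dot (c + c') x = dot c x + dot c' x.
Proof. by rewrite /dot -big_split; apply: eq_bigr => k _; rewrite mxE mulrzDr mulrDl. Qed.

Lemma dotZl (t : int) c x : dot (t *: c) x = t%:~R * dot c x.
Proof. by rewrite /dot big_distrr; apply: eq_bigr => k _; rewrite mxE intrM -mulrA. Qed.

Lemma dot_intpt c u : dot c (intpt R u) = (idot c u)%:~R.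
Proof. by rewrite rmorph_sum; apply: eq_bigr => k _; rewrite mxE rmorphM. Qed.

Lemma evN l x : ev (- l) x = - ev l x.
Proof. by rewrite /ev dotNl opprD mulrNz. Qed.

Lemma evD l x y : ev l (x + y) = ev l x + dot l.1 y.
Proof. by rewrite /ev dotDr addrAC. Qed.

Lemma evB l x y : ev l x - ev l y = dot l.1 (x - y).
Proof. by rewrite dotBr /ev; ring. Qed.

Lemma ev_comb l (t : R) x y :
  ev l (t *: x + (1 - t) *: y) = t * ev l x + (1 - t) * ev l y.
Proof. by rewrite /ev dotDr !dotZr; ring. Qed.

Lemma ev_move l (t : R) x y : ev l (x + t *: (y - x)) = t * ev l y + (1 - t) * ev l x.
Proof. by rewrite evD dotZr dotBr /ev; ring. Qed.

Lemma intptD a b : intpt R (a + b) = intpt R a + intpt R b :> vec.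
Proof. exact: map_mxD. Qed.

Lemma intptN a : intpt R (- a) = - intpt R a :> vec.
Proof. exact: map_mxN. Qed.

Lemma intpt_inj : injective (@intpt R N).
Proof.
move=> a b /rowP ab; apply/rowP => k; have := ab k.
by rewrite !mxE => /intr_inj.
Qed.

Definition rdot (c : 'rV[rat]_N) x : R := \sum_k ratr (c 0 k) * x 0 k.

Lemma rdot_rowq c x : rdot (rowq c) x = dot c x.
Proof. by apply: eq_bigr => k _; rewrite mxE ratr_int. Qed.

Lemma lspan_consP (c : 'rV[rat]_N) l L : (c <= lspan (l :: L))%MS ->
  exists (t : rat) c', (c' <= lspan L)%MS /\
    forall x, rdot c x = ratr t * dot l.1 x + rdot c' x.
Proof.
rewrite lspan_cons => /sub_addsmxP[[u v] /= ->].
exists (u 0 0), (v *m lspan L); split=> [|x]; first exact: submxMl.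
rewrite -rdot_rowq /rdot big_distrr -big_split /=; apply: eq_bigr => k _.
by rewrite 2!mxE big_ord1 rmorphD rmorphM /= mulrDl mulrA.
Qed.

Lemma lspan_const (c : 'rV[rat]_N) E : (c <= lspan E)%MS ->
  exists kappa, forall x, {in E, forall l, ev l x = 0} -> rdot c x = kappa.
Proof.
elim: E c => [|l E IH] c.
  rewrite /lspan big_nil submx0 => /eqP ->; exists 0 => x _.
  by rewrite /rdot big1 // => k _; rewrite mxE rmorph0 mul0r.
case/lspan_consP => t [c' [/IH [kappa c'k] cE]].
exists (kappa - ratr t * l.2%:~R) => x xE.
rewrite cE c'k => [|l' l'E]; last by rewrite xE // inE l'E orbT.
have := xE l (mem_head _ _); rewrite /ev => /eqP; rewrite addr_eq0 => /eqP ->.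
by rewrite mulrN addrC.
Qed.

Lemma lspan_rdot0 (c : 'rV[rat]_N) L y : (c <= lspan L)%MS ->
  {in L, forall l, dot l.1 y = 0} -> rdot c y = 0.
Proof.
elim: L c => [|l L IH] c.
  rewrite /lspan big_nil submx0 => /eqP -> _.
  by rewrite /rdot big1 // => k _; rewrite mxE rmorph0 mul0r.
case/lspan_consP => t [c' [/IH c'0 ->]] yL.
rewrite yL ?mem_head // mulr0 add0r c'0 // => l' l'L.
by rewrite yL // inE l'L orbT.
Qed.

Lemma lspan_dot0 (c : 'rV[int]_N) L y : (rowq c <= lspan L)%MS ->
  {in L, forall l, dot l.1 y = 0} -> dot c y = 0.
Proof. by rewrite -rdot_rowq; exact: lspan_rdot0. Qed.

Lemma real_kernel L y : y != 0 -> {in L, forall l, dot l.1 y = 0} ->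
  (\rank (lspan L) < N)%N.
Proof.
move=> y0 yL; rewrite ltn_neqAle rank_leq_row andbT; apply: contra y0 => full.
apply/eqP/rowP => k; rewrite mxE.
have /lspan_dot0 /(_ yL) : (rowq (delta_mx 0 k) <= lspan L)%MS.
  exact: submx_full.
rewrite /dot (bigD1 k) //= mxE !eqxx mul1r big1 ?addr0 // => j jk.
by rewrite mxE (negPf jk) andbF mul0r.
Qed.

Lemma lspan_ev_eq l E x y : (rowq l.1 <= lspan E)%MS ->
  {in E, forall l, ev l x = 0} -> {in E, forall l, ev l y = 0} -> ev l x = ev l y.
Proof.
move=> lE xE yE; apply/eqP; rewrite -subr_eq0 evB; apply/eqP.
by apply: lspan_dot0 lE _ => l' l'E; rewrite -evB xE // yE // subrr.
Qed.

Definition flips I I' := all2 (fun l l' => (l' == l) || (l' == - l)) I I'.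

Lemma flipsN I I' : flips I I' -> flips I (map -%R I').
Proof.
elim: I I' => [|l I IH] [|l' I'] //= /andP[ll' /IH ->]; rewrite andbT.
by case/orP: ll' => /eqP ->; rewrite ?opprK eqxx ?orbT.
Qed.

(** Modulo a form constant on E = 0, [c] is a combination of [I]. Flipping the forms with positive
    coefficient makes every coefficient nonpositive, so the same constant bounds [c] above or below
    according to the common sign of the flipped forms. *)
Lemma lspan_flips (c : 'rV[rat]_N) I E : (c <= lspan (I ++ E))%MS ->
  exists kappa I', flips I I' /\ forall x, {in E, forall l, ev l x = 0} ->
    ({in I', forall l, 0 <= ev l x} -> rdot c x <= kappa) /\
    ({in I', forall l, ev l x <= 0} -> kappa <= rdot c x).
Proof.
elim: I c => [|l I IH] c /=.
  by case/lspan_const => kappa ck; exists kappa, [::]; split=> // x /ck ->.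
case/lspan_consP => t [c' [/IH [kappa [I' [II' c'k]]] cE]].
pose l' := if t <= 0 then l else - l.
have l'E x : ratr t * ev l x = - (`|ratr t| * ev l' x).
  rewrite /l'; case: ifP => t0; first by rewrite ler0_norm ?lerq0 // mulNr opprK.
  by rewrite evN mulrN opprK ger0_norm // ler0q ltW // ltNge t0.
exists (kappa - ratr t * l.2%:~R), (l' :: I'); split.
  by rewrite /= II' andbT /l'; case: ifP; rewrite eqxx ?orbT.
move=> x /c'k[le ge]; rewrite cE.
have -> : dot l.1 x = ev l x - l.2%:~R by rewrite /ev addrK.
rewrite mulrBr l'E; split=> xI'.
  have := le (fun m mI => xI' m (mem_behead (s := l' :: I') mI)).
  have : 0 <= `|ratr t| * ev l' x by rewrite mulr_ge0 // xI' // mem_head.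
  lra.
have := ge (fun m mI => xI' m (mem_behead (s := l' :: I') mI)).
have : `|ratr t| * ev l' x <= 0 by rewrite mulr_ge0_le0 // xI' // mem_head.
lra.
Qed.

(* When I is linearly dependent modulo E, some choice of signs makes the strict
   system infeasible; one walks back from it to I flipping one sign at a time. *)
Lemma flip_ind (X : seq form -> seq form -> Prop) :
  (forall E I I', perm_eq I I' -> X E I -> X E I') ->
  (forall E l I, X E I -> X (l :: E) I -> X E (- l :: I) -> X E (l :: I)) ->
  (forall E I, (forall x, {in E, forall l, ev l x = 0} ->
     ~ {in I, forall l, 0 < ev l x}) -> X E I) ->
  (forall E I, indep E I -> X E I) ->
  forall E I, X E I.
Proof.
move=> Xperm Xflip Xinf Xind E I.
have [n] := ubnP (size I); elim: n E I => // n IH E I; rewrite ltnS => In.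
have [/Xind//|/Nindep[l [J [IlJ lEJ]]]] := boolP (indep E I).
apply: (Xperm E (l :: J)); first by rewrite perm_sym.
move/perm_size: IlJ => /= sI; rewrite sI in In => {I sI}.
(* The two systems without [m] among the inequalities are shorter, hence known by induction. *)
have flip1 (m : form) (K : seq form) : size K = size J -> X E (- m :: K) -> X E (m :: K).
  by move=> KJ; apply: Xflip; apply: IH; rewrite KJ.
(* Signs are changed one at a time; [K] is the prefix on which both systems already agree, and the
   constant total size lets [flip1] apply. *)
have flipK K I1 I2 : flips I1 I2 -> (size K + size I1 = size J)%N ->
    forall m, X E (m :: K ++ I2) -> X E (m :: K ++ I1).
  elim: I1 I2 K => [|i I1 IH1] [|i2 I2] //= K /andP[ii2 II2] sK m.
  move=> XI2; rewrite -cat_rcons.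
  apply: (IH1 I2 (rcons K i)) => //; first by rewrite size_rcons addSnnS.
  rewrite cat_rcons.
  case/orP: ii2 => /eqP i2E; first by rewrite -i2E.
  have mid (z : form) (A B : seq form) : perm_eq (z :: A ++ B) (A ++ z :: B).
    by rewrite perm_sym; exact: permEl (perm_catCA A [:: z] B).
  apply: (Xperm _ _ _ (mid i (m :: K) I2)); apply: flip1.
    rewrite /= size_cat -sK.
    suff -> : size I2 = size I1 by rewrite addnS.
    by elim: I1 I2 II2 {IH1 sK XI2} => [|? ? IH2] [|? ?] //= /andP[_ /IH2 ->].
  by apply: Xperm XI2; rewrite perm_sym -i2E; exact: (mid i2 (m :: K) I2).
have {lEJ} : (rowq l.1 <= lspan (J ++ E))%MS.
  by rewrite (@perm_lspan _ _ (E ++ J)) // perm_catC.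
case/lspan_flips => kappa [I' [JI' lk]].
have bound x : {in E, forall l, ev l x = 0} ->
    ({in I', forall l, 0 <= ev l x} -> ev l x <= kappa + l.2%:~R) /\
    ({in I', forall l, ev l x <= 0} -> kappa + l.2%:~R <= ev l x).
  by move=> /lk[le ge]; rewrite /ev !lerD2r -rdot_rowq; split.
(* If this bound is not positive, I' > 0 excludes l > 0; if it is positive, -I' > 0 excludes l < 0.
   Either way an infeasible choice of signs is found. *)
have [k0|k0] := lerP (kappa + l.2%:~R) 0.
  apply: (flipK [::] _ _ JI') => //=; apply: Xinf => x xE xI.
  have := xI l (mem_head _ _); rewrite ltNge => /negP; apply.
  apply: le_trans k0; apply: (bound x xE).1 => m mI'.
  by apply/ltW/xI; rewrite inE mI' orbT.
apply: flip1 => //; apply: (flipK [::] _ _ (flipsN JI')) => //=.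
apply: Xinf => x xE xI; have := xI _ (mem_head _ _).
rewrite evN oppr_gt0 ltNge => /negP; apply.
apply: le_trans (ltW k0) ((bound x xE).2 _) => m mI'.
have := xI (- m); rewrite inE (map_f -%R mI') orbT evN oppr_gt0 => /(_ isT).
exact: ltW.
Qed.

End RealForms.

(** * Rationality and reciprocity for strictly feasible systems of forms *)

Section Reciprocity.
Variables (R : realType) (N : nat) (K : fieldType).
Variables (phi : {rmorphism rat -> K}) (q : 'I_N -> K).
Hypothesis qvar_neq0 : forall k, q k != 0.
Hypothesis q_indep : forall u : 'rV[int]_N, monom q u = 1 -> u = 0.
Local Notation vec := 'rV[R]_N.
Local Notation form := (form N).
Local Notation rep := (rep q).
Local Notation pt a := (intpt R a).
Implicit Types (x y w : vec) (l : form) (E I L A B : seq form) (a u : 'rV[int]_N).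

Definition opn E I x : bool :=
  all (fun l => ev l x == 0) E && all (fun l => 0 < ev l x) I.

(* For w in Q = {E = 0, I >= 0} this is the cone opposite to the tangent cone of
   Q at w, translated to w. *)
Definition opp_cone w E I x : bool :=
  [&& all (fun l => ev l w == 0) E, all (fun l => 0 <= ev l w) I,
      all (fun l => ev l x == 0) E &
      all (fun l => (ev l w == 0) ==> (ev l x <= 0)) I].

(** Interpolates between the closed cone ([B] empty) and the strict system ([A] empty). *)
Definition mixed E A B x : bool :=
  opn E B x && all (fun l => ev l x <= 0) A.

Definition active w I := [seq l <- I | ev l w == 0].

Lemma opnP E I x :
  reflect ({in E, forall l, ev l x = 0} /\ {in I, forall l, 0 < ev l x}) (opn E I x).
Proof.
apply: (iffP andP) => [[/allP xE /allP xI]|[xE xI]].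
  by split=> // l /xE/eqP.
by split; apply/allP => // l /xE/eqP.
Qed.

Lemma opn_flip E l I x :
  (opn E (l :: I) x)%:R + (opn E (- l :: I) x)%:R + (opn (l :: E) I x)%:R =
  (opn E I x)%:R :> rat.
Proof.
rewrite /opn /= evN oppr_gt0.
by case: ltrgtP => _; case: all; case: all; rewrite /= ?addr0 ?add0r.
Qed.

(** If l(w) is nonzero, w lies on one side only and l is inactive there. If l(w) = 0, the
    half-spaces l(x) <= 0 and l(x) >= 0 cover the space and overlap in l(x) = 0. *)
Lemma opp_cone_flip w E l I x :
  (opp_cone w E (l :: I) x)%:R + (opp_cone w E (- l :: I) x)%:R =
  (opp_cone w E I x)%:R + (opp_cone w (l :: E) I x)%:R :> rat.
Proof.
rewrite /opp_cone /= !evN oppr_ge0 oppr_le0 oppr_eq0.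
case: (ltrgtP (ev l w) 0) => _; case: (ltrgtP (ev l x) 0) => _;
by rewrite /= ?andbF ?andbT; do 4?case: (all _ _); rewrite /= ?addr0 ?add0r.
Qed.

Lemma mixed_cons E l A B x :
  (mixed E (l :: A) B x)%:R = (mixed E A B x)%:R - (mixed E A (l :: B) x)%:R :> rat.
Proof.
rewrite /mixed /opn /= leNgt.
by case: ltrP => _; do 3?case: (all _ _); rewrite /= ?subrr ?subr0.
Qed.

Lemma ev_shift l a u : ev l (pt (a - u)) = ev l (pt a) - (idot l.1 u)%:~R.
Proof. by rewrite intptD intptN evD dotNr dot_intpt. Qed.

Lemma mixed_shift E A B u a :
  {in E ++ A ++ B, forall l, idot l.1 u = 0} ->
  mixed E A B (pt (a - u)) = mixed E A B (pt a).
Proof.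
move=> u0; have ev0 l : l \in E ++ A ++ B -> ev l (pt (a - u)) = ev l (pt a).
  by move=> /u0 lu; rewrite ev_shift lu subr0.
by rewrite /mixed /opn; congr (_ && _ && _); apply: eq_in_all => l lL;
  rewrite ev0 // !mem_cat lL ?orbT.
Qed.

Lemma rep_mixed0 E A B u : u != 0 -> {in E ++ A ++ B, forall l, idot l.1 u = 0} ->
  rep (fun a => (mixed E A B (pt a))%:R) 0.
Proof.
by move=> u0 uE; apply: rep_invariant u0 _ => // a; rewrite mixed_shift.
Qed.

Lemma opn_mixed E I x : opn E I x = mixed E [::] I x.
Proof. by rewrite /mixed andbT. Qed.

Lemma rep_opn0 E I u : u != 0 -> {in E ++ I, forall l, idot l.1 u = 0} ->
  rep (fun a => (opn E I (pt a))%:R) 0.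
Proof.
move=> u0 /(@rep_mixed0 E [::] I _ u0).
by apply: eq_rep => a; rewrite opn_mixed.
Qed.

Lemma idot_gt0 c u : 0 < idot c u -> u != 0.
Proof.
by apply: contraTneq => ->; rewrite -leNgt /idot big1 // => k _; rewrite mxE mulr0.
Qed.

Lemma rep_false (F : 'rV[int]_N -> bool) : (forall a, ~~ F a) ->
  rep (fun a => (F a)%:R) 0.
Proof.
move=> F0; apply: (eq_rep _ (rep0 phi q)) => a.
by rewrite (negPf (F0 a)).
Qed.

Lemma count_int (z : int) (m : nat) :
  (0 < z)%R%:R - (m%:Z < z)%R%:R = \sum_(t < m) (z == t.+1%:Z)%:R :> rat.
Proof.
elim: m => [|m IH]; first by rewrite subrr big_ord0.
rewrite big_ord_recr -IH /=.
have -> : (m%:Z < z) = (m.+1%:Z < z) || (z == m.+1%:Z) by lia.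
have : ~~ ((m.+1%:Z < z) && (z == m.+1%:Z)) by lia.
by case: (m.+1%:Z < z); case: (z == m.+1%:Z) => // _; rewrite ?addr0 ?subrK.
Qed.

(** Take u killed by all forms but l, with m = l(u) - l(0) > 0. Translation by u maps the set into
    itself and misses only the slices l = 1, ..., m, known by induction, so [rep_diff] concludes.
    Without inequalities, the solutions are invariant under an integer translation or contain at
    most one integer point. *)
Lemma rep_opn_indep E I : indep E I ->
  exists f, rep (fun a => (opn E I (pt a))%:R) f.
Proof.
elim: I E => [|l I IH] E ind.
  have [rE|] := ltnP (\rank (lspan E)) N.
    have [u [u0 uE]] := integer_kernel rE.
    by exists 0; apply: rep_opn0 u0 _; rewrite cats0.
  move=> rE; have [[a0 a0E]|noE] := pselect (exists a0, opn E [::] (pt a0)).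
    exists (monom q a0); apply: (eq_rep _ (rep_monom phi q a0)) => a.
    congr ((nat_of_bool _)%:R); apply/eqP/idP => [->//|aE].
    apply/eqP/negPn/negP => aa0; move: rE; rewrite leqNgt => /negP; apply.
    apply: (@real_kernel R N E (pt a - pt a0)).
      by rewrite subr_eq0 (inj_eq (@intpt_inj _ _)).
    move=> m mE; rewrite -evB.
    by case/opnP: aE => /(_ m mE) -> _; case/opnP: a0E => /(_ m mE) -> _; rewrite subrr.
  by exists 0; apply: rep_false => a; apply/negP => aE; apply: noE; exists a.
have [u [uEI lu]] := separate (indep_notin ind).
have /(rep_diff phi qvar_neq0 q_indep) : u != 0 by exact: idot_gt0 lu.
pose m := `|idot l.1 u|%N.
have mE : idot l.1 u = m%:Z by rewrite gtz0_abs.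
(* The form l - (t + 1): indices start at 0 but slices at l = 1, since l > 0 is strict. *)
pose lt (t : nat) : form := (l.1, l.2 - t.+1%:Z).
have /choice[f fP] (t : nat) : exists f, rep (fun a => (opn (lt t :: E) I (pt a))%:R) f.
  exact/IH/(indep_move _ ind).
move=> repF; apply: (repF _ (\sum_(t < m) f t)).
have := rep_sum phi qvar_neq0 (index_enum 'I_m) (P := xpredT) (fun t _ => fP t).
apply: eq_rep => a.
have evz (c : form) : ev c (pt a) = (idot c.1 a + c.2)%:~R.
  by rewrite /ev dot_intpt rmorphD.
have opnE b : opn E (l :: I) (pt b) = (0 < ev l (pt b)) && opn E I (pt b).
  by rewrite /opn /= andbCA.
rewrite !opnE ev_shift.
rewrite !opn_mixed mixed_shift // -opn_mixed mE evz -intrB !ltr0z.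
set z := idot _ _ + _; rewrite subr_gt0.
under eq_bigr => t _.
  have -> : opn (lt t :: E) I (pt a) = (z == t.+1%:Z) && opn E I (pt a).
    rewrite /opn /= -andbA evz /= addrA -/z intr_eq0 subr_eq0 //.
  over.
case: (opn E I (pt a)).
  under eq_bigr => t _ do rewrite andbT.
  by rewrite -count_int !andbT.
by under eq_bigr => t _ do rewrite andbF; rewrite !andbF subrr big1.
Qed.

(** The sign-flipping induction reduces this to independent systems; the witness f - h - g is read
    off from [opn_flip]. *)
Lemma rep_opn E I : exists f, rep (fun a => (opn E I (pt a))%:R) f.
Proof.
move: E I; apply: (@flip_ind R N).
- move=> E I I' II' [f fP]; exists f; apply: eq_rep fP => a.
  by rewrite /opn (perm_all _ II').
- move=> E l I [f fP] [g gP] [h hP]; exists (f - h - g).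
  have := repB phi qvar_neq0 (repB phi qvar_neq0 fP hP) gP.
  by apply: eq_rep => a; rewrite -(opn_flip E l I (pt a)); ring.
- move=> E I inf; exists 0; apply: rep_false => a.
  by apply/opnP => -[/inf].
- exact: rep_opn_indep.
Qed.

Lemma rep_mixed E A B : exists f, rep (fun a => (mixed E A B (pt a))%:R) f.
Proof.
elim: A B => [|l A IH] B.
  have [f fP] := rep_opn E B; exists f.
  by apply: eq_rep fP => a; rewrite opn_mixed.
have [f fP] := IH B; have [g gP] := IH (l :: B).
by exists (f - g); apply: eq_rep (repB phi qvar_neq0 fP gP) => a; rewrite mixed_cons.
Qed.

Lemma opp_cone_mixed w E I x :
  all (fun l => ev l w == 0) E -> all (fun l => 0 <= ev l w) I ->
  opp_cone w E I x = mixed E (active w I) [::] x.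
Proof.
move=> wE wI; rewrite /opp_cone /mixed /opn wE wI /= andbT; congr (_ && _).
by rewrite /active all_filter; apply: eq_all => l /=; rewrite implybE.
Qed.

Lemma rep_opp_cone w E I : exists f, rep (fun a => (opp_cone w E I (pt a))%:R) f.
Proof.
have [/andP[wE wI]|wQ] :=
  boolP (all (fun l => ev l w == 0) E && all (fun l => 0 <= ev l w) I).
  have [f fP] := rep_mixed E (active w I) [::].
  by exists f; apply: eq_rep fP => a; rewrite opp_cone_mixed.
exists 0; apply: rep_false => a; apply: contra wQ.
by rewrite /opp_cone => /and3P[-> ->].
Qed.

(** Either w is infeasible and the indicator is empty, or an integer vector killed by [E] and the
    active forms leaves the cone invariant. *)
Lemma rep_opp_cone0 w E I :
  (\rank (lspan (E ++ active w I)) < N)%N ->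
  rep (fun a => (opp_cone w E I (pt a))%:R) 0.
Proof.
move=> rk.
have [/andP[wE wI]|wQ] :=
  boolP (all (fun l => ev l w == 0) E && all (fun l => 0 <= ev l w) I).
  have [u [u0 uE]] := integer_kernel rk.
  apply: (eq_rep _ (@rep_mixed0 E (active w I) [::] u u0 _)) => [a|].
    by rewrite opp_cone_mixed.
  by rewrite cats0.
apply: rep_false => a; apply: contra wQ.
by rewrite /opp_cone => /and3P[-> ->].
Qed.

(** Replacing l <= 0 by l > 0 costs a sign: the two indicators add up to one without l, which is
    invariant along an integer vector killed by the remaining forms. *)
Lemma rep_mixed_opn E A B : indep E (A ++ B) ->
  rep (fun a => (mixed E A B (pt a))%:R -
                (-1) ^+ size A * (opn E (A ++ B) (pt a))%:R) 0.
Proof.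
elim: A B => [|l A IH] B ind.
  by apply: eq_rep (rep0 phi q) => a; rewrite opn_mixed expr0 mul1r subrr.
have mid : perm_eq (l :: A ++ B) (A ++ l :: B).
  by rewrite perm_sym; exact: permEl (perm_catCA A [:: l] B).
have [u [uEI lu]] := separate (indep_notin ind).
have M0 := @rep_mixed0 E A B u (idot_gt0 lu) uEI.
have := IH (l :: B); rewrite -(perm_indep _ mid) => /(_ ind) M1.
have := repB phi qvar_neq0 M0 M1; rewrite subr0; apply: eq_rep => a.
rewrite mixed_cons /= exprS.
have -> : opn E (A ++ l :: B) (pt a) = opn E (l :: A ++ B) (pt a).
  by rewrite /opn (perm_all _ mid).
by ring.
Qed.

(** Produces the apex of the cone: moving along a vector that changes only l makes l vanish and
    keeps the zeros already obtained. *)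
Lemma indep_solve E I x : indep E I -> {in E, forall l, ev l x = 0} ->
  exists w, {in E ++ I, forall l, ev l w = 0}.
Proof.
move=> + xE; elim: I => [|l I IH] ind; first by exists x; rewrite cats0.
have [u [uEI lu]] := separate (indep_notin ind).
have [w wEI] := IH (indep_behead ind).
exists (w - (ev l w / (idot l.1 u)%:~R) *: pt u) => m.
rewrite mem_cat inE evD dotNr dotZr dot_intpt orbCA => /predU1P[->|mEI].
  by rewrite divfK ?subrr // intr_eq0 gt_eqF.
by rewrite -mem_cat in mEI; rewrite (wEI m) // (uEI m) // mulr0z mulr0 subr0.
Qed.

Lemma small_step I x y :
  {in I, forall l, 0 <= ev l x /\ (ev l x = 0 -> 0 <= dot l.1 y)} ->
  exists2 e, 0 < e & forall t, 0 <= t <= e -> {in I, forall l, 0 <= ev l (x + t *: y)}.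
Proof.
elim: I => [|l I IH] xI; first by exists 1.
have [m mI|e e0 eI] := IH; first by apply: xI; rewrite inE mI orbT.
have [lx0 l0] := xI l (mem_head _ _).
have [d d0 dl] : exists2 d, 0 < d & forall t, 0 <= t <= d -> 0 <= ev l (x + t *: y).
  have [ly|ly] := lerP 0 (dot l.1 y).
    by exists 1 => // t /andP[t0 _]; rewrite evD dotZr addr_ge0 ?mulr_ge0.
  have lx : 0 < ev l x.
    rewrite lt_neqAle lx0 andbT eq_sym; apply/eqP => /l0.
    by rewrite leNgt ly.
  exists (ev l x / - dot l.1 y); first by rewrite divr_gt0 ?oppr_gt0.
  by move=> t /andP[t0]; rewrite ler_pdivlMr ?oppr_gt0 // evD dotZr; lra.
exists (Num.min e d); first by rewrite lt_min e0.
move=> t; rewrite le_min => /and3P[t0 te td] m; rewrite inE => /predU1P[->|mI].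
  by apply: dl; rewrite t0.
by apply: eI; rewrite ?t0.
Qed.

Lemma small_step_lt I x y : {in I, forall l, 0 < ev l x} ->
  exists2 e, 0 < e & {in I, forall l, 0 < ev l (x + e *: y)}.
Proof.
move=> xI; have [l lI|e e0 eI] := @small_step I x y.
  by rewrite ltW ?xI //; split=> // lx; have := xI l lI; rewrite lx ltxx.
(* At e / 2 a form is the mean of its positive value at x and its nonnegative value at x + e y. *)
exists (e / 2); first by rewrite divr_gt0.
move=> l lI; have := xI l lI; have := eI e _ l lI.
rewrite !evD !dotZr => /(_ _); rewrite lexx ltW // => /(_ isT); lra.
Qed.

Lemma opn_implied E l I : (forall x, opn E I x -> 0 < ev l x) ->
  forall x, opn E (l :: I) x = opn E I x.
Proof.
move=> El x; apply/idP/idP => [/and3P[xE _ xI]|xI]; first by apply/andP.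
by move: (xI) => /andP[xE xI']; apply/and3P; split=> //; exact: El.
Qed.

(** If l(w) < 0, the segment from w to x0 would cross l = 0, at parameter [t], in a point that is
    still strictly feasible. *)
Lemma closed_implied E l I x0 w : opn E I x0 -> (forall x, opn E I x -> 0 < ev l x) ->
  {in E, forall l, ev l w = 0} -> {in I, forall l, 0 <= ev l w} -> 0 <= ev l w.
Proof.
move=> x0I El wE wI; rewrite leNgt; apply/negP => lw.
have lx0 := El _ x0I; have /opnP[x0E x0J] := x0I.
pose t := - ev l w / (ev l x0 - ev l w).
have t0 : 0 < t by rewrite divr_gt0 ?subr_gt0 ?oppr_gt0 // (lt_trans lw).
have t1 : t < 1 by rewrite ltr_pdivrMr ?mul1r; lra.
have := El (w + t *: (x0 - w)).
have -> : ev l (w + t *: (x0 - w)) = 0.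
  rewrite ev_move /t; field; apply/eqP => e; lra.
rewrite ltxx => H; suff : false by [].
apply: H; apply/opnP; split=> m mL; rewrite ev_move.
  by rewrite wE // x0E // !mulr0 addr0.
have := mulr_gt0 t0 (x0J m mL).
have : 0 <= (1 - t) * ev m w by rewrite mulr_ge0 ?wI // subr_ge0 ltW.
lra.
Qed.

(** If l vanished at w and were positive at some x of the opposite cone, a small step from w away
    from x would stay feasible and make l negative, against [closed_implied]. *)
Lemma opp_cone_implied E l I x0 w : opn E I x0 -> (forall x, opn E I x -> 0 < ev l x) ->
  forall x, opp_cone w E (l :: I) x = opp_cone w E I x.
Proof.
move=> x0I El x; rewrite /opp_cone /=.
case wE : (all _ E) => //=; case wI : (all (fun l => 0 <= ev l w) I);
  last by rewrite andbF.
case xE : (all (fun l => ev l x == 0) E); last by rewrite !andbF.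
case xI : (all (fun l => (ev l w == 0) ==> (ev l x <= 0)) I); last by rewrite !andbF.
rewrite !andbT /=.
move/allP: wE => wE; move/allP: wI => wI; move/allP: xE => xE; move/allP: xI => xI.
have clo z := @closed_implied E l I x0 z x0I El.
have lw : 0 <= ev l w by apply: clo => // m /wE/eqP.
rewrite lw /=; apply/implyP => /eqP lw0; rewrite leNgt; apply/negP => lx.
have [m mI|e e0 eI] := @small_step I w (w - x).
  split; first exact: wI.
  move=> mw; rewrite -evB mw sub0r oppr_ge0.
  by have /implyP := xI m mI; apply; rewrite mw.
have := clo (w + e *: (w - x)); rewrite evD dotZr -evB lw0 add0r sub0r.
rewrite mulrN oppr_ge0 leNgt mulr_gt0 // => /(_ _ _) => H.
suff : false by [].
apply: H => [m mE|]; last by apply: eI; rewrite ltW /=.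
by rewrite evD dotZr -evB (eqP (wE m mE)) (eqP (xE m mE)) subrr mulr0 addr0.
Qed.

(* W0 plays the role of the vertex set: at any other point the opposite cone is
   empty or contains a rational line. *)
Definition reciprocal E I := (exists x, opn E I x) ->
  exists W0 : seq vec, forall W : seq vec, uniq W -> {subset W0 <= W} ->
  rep (fun a => \sum_(w <- W) (opp_cone w E I (pt a))%:R -
                (-1) ^+ (N + \rank (lspan E)) * (opn E I (pt a))%:R) 0.

Lemma reciprocal_implied E l I : (forall x, opn E I x -> 0 < ev l x) ->
  reciprocal E I -> reciprocal E (l :: I).
Proof.
move=> El EI [x0 x0I]; rewrite (opn_implied El) in x0I.
have [W0 W0P] := EI (ex_intro _ x0 x0I); exists W0 => W uW WW.
apply: eq_rep (W0P W uW WW) => a; rewrite (opn_implied El).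
by congr (_ - _); apply: eq_bigr => w _; rewrite (opp_cone_implied w x0I El).
Qed.

(** If l > 0 is not implied by the rest, both open sides of l = 0 and the slice itself are strictly
    feasible; the three known identities then combine by [opn_flip] and [opp_cone_flip]. *)
Lemma reciprocal_flip E l I : reciprocal E I -> reciprocal (l :: E) I ->
  reciprocal E (- l :: I) -> reciprocal E (l :: I).
Proof.
move=> EI lEI NlI [x0 x0I].
have [El|] := pselect (forall x, opn E I x -> 0 < ev l x).
  by apply: reciprocal_implied EI _ => //; exists x0.
move=> /existsNP[x1] /not_implyP[x1I /negP]; rewrite -leNgt => lx1.
have /opnP[x0E x0lI] := x0I; have lx0 := x0lI _ (mem_head _ _).
have x0J : {in I, forall l, 0 < ev l x0} by move=> m mI; apply: x0lI; rewrite inE mI orbT.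
have /opnP[x1E x1J] := x1I.
have lE : ~~ (rowq l.1 <= lspan E)%MS.
  apply/negP => lE; have := lspan_ev_eq lE x0E x1E; lra.
(* The point x1 may lie on l = 0; a small push along -u makes l negative. *)
have [x2 x2I] : exists x, opn E (- l :: I) x.
  have [u [uE lu]] := separate lE.
  have [e e0 eI] := small_step_lt (- pt u) x1J.
  exists (x1 + e *: - pt u); apply/opnP; split=> m.
    by move=> mE; rewrite evD dotZr dotNr dot_intpt uE // mulr0z oppr0 mulr0 addr0 x1E.
  rewrite inE => /predU1P[->|/eI //].
  rewrite evN oppr_gt0 evD dotZr dotNr dot_intpt mulrN ltr_wnDl // oppr_lt0.
  by rewrite mulr_gt0 // ltr0z.
have [x3 x3I] : exists x, opn (l :: E) I x.
  have /opnP[x2E x2lI] := x2I.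
  have lx2 := x2lI _ (mem_head _ _); rewrite evN oppr_gt0 in lx2.
  pose t := ev l x0 / (ev l x0 - ev l x2).
  have t0 : 0 < t by rewrite divr_gt0 // subr_gt0 (lt_trans lx2).
  have t1 : t < 1 by rewrite ltr_pdivrMr ?mul1r; lra.
  exists (x0 + t *: (x2 - x0)); apply/opnP; split=> m.
    rewrite inE ev_move => /predU1P[->|mE].
      by rewrite /t; field; apply/eqP => e; lra.
    by rewrite x0E // x2E // !mulr0 addr0.
  move=> mI; rewrite ev_move addr_gt0 // mulr_gt0 ?subr_gt0 ?x0J //.
  by apply: x2lI; rewrite inE mI orbT.
have [W1 W1P] := EI (ex_intro _ x1 x1I).
have [W2 W2P] := lEI (ex_intro _ x3 x3I).
have [W3 W3P] := NlI (ex_intro _ x2 x2I).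
exists (W1 ++ W2 ++ W3) => W uW sW.
have [s1 s2 s3] : [/\ {subset W1 <= W}, {subset W2 <= W} & {subset W3 <= W}].
  by split=> w wW; apply: sW; rewrite !mem_cat wW ?orbT.
have := repB phi qvar_neq0 (repD phi qvar_neq0 (W1P W uW s1) (W2P W uW s2)) (W3P W uW s3).
rewrite addr0 subr0; apply: eq_rep => a.
(* Adding l to [E] raises the rank by one, so the slice comes with the opposite sign and cancels the
   slice term of [opn_flip]. *)
rewrite (rank_lspan_cons lE) addnS exprS -(opn_flip E l I (pt a)).
have arith (p r t v s x y z : rat) : p + r = t + v ->
    t - s * (x + y + z) + (v - -1 * s * z) - (r - s * y) = p - s * x.
  by move=> /(canRL (addrK _)) ->; ring.
apply: arith; rewrite -!big_split; apply: eq_bigr => w _; exact: opp_cone_flip.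
Qed.

(** In rank below N every set involved is empty or invariant under an integer translation, so all
    values are 0. In rank N the polyhedron is a simplicial cone in which only the apex w0 counts,
    and [rep_mixed_opn] compares its reversal with its interior. *)
Lemma reciprocal_indep E I : indep E I -> reciprocal E I.
Proof.
move=> ind [x0 /opnP[x0E _]].
have rest (W : seq vec) (P : pred vec) :
    (forall w, P w -> \rank (lspan (E ++ active w I)) < N)%N ->
    rep (fun a => \sum_(w <- W | P w) (opp_cone w E I (pt a))%:R) 0.
  move=> rk; have := rep_sum phi qvar_neq0 W (fun w Pw => rep_opp_cone0 (rk w Pw)).
  by rewrite big1.
have [rEI|rEI] := ltnP (\rank (lspan (E ++ I))) N.
  exists [::] => W _ _; have [u [u0 uE]] := integer_kernel rEI.
  have Wr := rest W xpredT.
  have := repZ phi qvar_neq0 ((-1) ^+ (N + \rank (lspan E))) (rep_opn0 u0 uE).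
  rewrite mulr0 => /(repB phi qvar_neq0 (Wr _)); rewrite subr0; apply => w _.
  apply: leq_ltn_trans rEI; apply/mxrankS/lspanS => l.
  by rewrite !mem_cat /active mem_filter => /orP[->//|/andP[_ ->]]; rewrite orbT.
have {rEI} rN : (\rank (lspan E) + size I = N)%N.
  by apply/eqP; rewrite -(eqP ind) eqn_leq rank_leq_row rEI.
have [w0 w0EI] := indep_solve ind x0E.
exists [:: w0] => W uW w0W.
have Wr : rep (fun a => \sum_(w <- W | w != w0) (opp_cone w E I (pt a))%:R) 0.
  pose inQ (w : vec) := all (fun l => ev l w == 0) E.
  have WQ (w : vec) : w != w0 -> rep (fun a => (opp_cone w E I (pt a))%:R) 0.
    move=> ww0; have [wE|wE] := boolP (inQ w); last first.
      by apply: rep_false => a; apply: contra wE => /andP[].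
    (* All forms vanish at w0, so w - w0 is a nonzero kernel vector of [E] and of the forms active
       at w. *)
    apply: rep_opp_cone0; apply: (@real_kernel R N _ (w - w0)).
      by rewrite subr_eq0.
    move=> l; rewrite mem_cat mem_filter -evB => lEI.
    have -> : ev l w0 = 0.
      by apply: w0EI; rewrite mem_cat; case/orP: lEI => [->//|/andP[_ ->]]; rewrite orbT.
    rewrite subr0; case/orP: lEI => [lE|/andP[/eqP->//]].
    by apply/eqP; move/allP: wE; apply.
  by have := rep_sum phi qvar_neq0 W WQ; rewrite big1.
have := rep_mixed_opn (A := I) (B := [::]); rewrite cats0 => /(_ _ ind).
move/(repD phi qvar_neq0 Wr); rewrite addr0; apply: eq_rep => a.
have w0Z l : l \in E ++ I -> ev l w0 == 0 by move=> /w0EI ->.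
have -> : mixed E I [::] (pt a) = opp_cone w0 E I (pt a).
  rewrite opp_cone_mixed; last 2 first.
  - by apply/allP => l lE; rewrite w0Z // mem_cat lE.
  - by apply/allP => l lI; rewrite w0EI // mem_cat lI orbT.
  rewrite /active (eq_in_filter (a2 := xpredT)) ?filter_predT // => l lI.
  by rewrite w0Z // mem_cat lI orbT.
(* As N is the rank of [E] plus the size of [I], the two exponents have the same parity. *)
have -> : (-1) ^+ (N + \rank (lspan E)) = (-1) ^+ size I :> rat.
  by rewrite -{1}rN addnAC addnn -mul2n exprD exprM sqrrN expr1n mul1r.
by rewrite (bigD1_seq w0) ?w0W ?mem_head //= addrA [_ + (opp_cone _ _ _ _)%:R]addrC.
Qed.

Theorem reciprocalP E I : reciprocal E I.
Proof.
move: E I; apply: (@flip_ind R N).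
- move=> E I I' II' EI [x xI'].
  have opnE y : opn E I' y = opn E I y by rewrite /opn (perm_all _ II').
  have oppE w y : opp_cone w E I' y = opp_cone w E I y.
    by rewrite /opp_cone !(perm_all _ II').
  rewrite opnE in xI'; have [W0 W0P] := EI (ex_intro _ x xI').
  exists W0 => W uW sW; apply: eq_rep (W0P W uW sW) => a.
  by rewrite opnE; under [in RHS]eq_bigr => w _ do rewrite oppE.
- exact: reciprocal_flip.
- by move=> E I inf [x /opnP[/inf]].
- exact: reciprocal_indep.
Qed.

End Reciprocity.

(** * Integral polytopes as solution sets of integer inequalities *)

Section Polytopes.
Variables (R : realType) (N : nat).
Local Notation vec := 'rV[R]_N.
Local Notation form := (form N).
Local Notation pt a := (intpt R a).
Implicit Types (x y z w v : vec) (l : form) (E I J L : seq form) (a u : 'rV[int]_N).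
Implicit Types (A P : set vec) (s : seq vec).

Lemma convex_setP A : @convex_set R 'rV[R]_N A <->
  forall x y (t : R), A x -> A y -> 0 <= t <= 1 -> A (t *: x + (1 - t) *: y).
Proof.
split=> [cA x y t /mem_set xA /mem_set yA /andP[t0 t1]|cA x y t /set_mem xA /set_mem yA].
  by have /set_mem := cA x y (Itv01 t0 t1) xA yA.
by apply/mem_set; apply: (cA x y t%:num xA yA); rewrite ge0 le1.
Qed.

Lemma convex_hull_convex A : @convex_set R 'rV[R]_N (convex_hull A).
Proof.
apply/convex_setP => x y t xA yA t01 B [cB AB].
by move/convex_setP: (cB); apply=> //; [apply: xA|apply: yA].
Qed.

Lemma convex_hull_min A B : @convex_set R 'rV[R]_N B -> A `<=` B -> convex_hull A `<=` B.
Proof. by move=> cB AB; apply: smallest_sub. Qed.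

(* (y, h) belongs to the cone generated by s * {1}. *)
Fixpoint in_cone s (y : vec) (h : R) : Prop :=
  if s is v :: s' then exists2 t, 0 <= t & in_cone s' (y - t *: v) (h - t)
  else y = 0 /\ h = 0.

Lemma in_cone0 s : in_cone s 0 0.
Proof. by elim: s => //= v s IH; exists 0; rewrite ?scale0r ?subr0. Qed.

Lemma in_coneD s y h y' h' : in_cone s y h -> in_cone s y' h' ->
  in_cone s (y + y') (h + h').
Proof.
elim: s y h y' h' => [|v s IH] y h y' h' /=.
  by case=> -> -> [-> ->]; rewrite !addr0.
move=> [t t0 yt] [t' t'0 yt']; exists (t + t'); first exact: addr_ge0.
have := IH _ _ _ _ yt yt'.
by rewrite scalerDl !opprD ![_ - _ + (_ - _)]addrACA.
Qed.

Lemma in_coneZ s y h (c : R) : 0 <= c -> in_cone s y h -> in_cone s (c *: y) (c * h).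
Proof.
move=> c0; elim: s y h => [|v s IH] y h /=; first by case=> -> ->; rewrite scaler0 mulr0.
move=> [t t0 /IH yt]; exists (c * t); first exact: mulr_ge0.
by move: yt; rewrite scalerBr mulrBr scalerA.
Qed.

Lemma in_cone_mem s v : v \in s -> in_cone s v 1.
Proof.
elim: s => //= w s IH; rewrite inE => /predU1P[->|vs].
  by exists 1 => //; rewrite scale1r !subrr; exact: in_cone0.
by exists 0 => //; rewrite scale0r !subr0; exact: IH.
Qed.

(** The first generator is split off with weight t / h and the rest renormalised by h - t; at h = 0
    all weights vanish. *)
Lemma in_cone_convex s A : @convex_set R 'rV[R]_N A -> {in s, forall v, A v} ->
  forall y h, in_cone s y h ->
  0 <= h /\ (h = 0 -> y = 0) /\ (0 < h -> A (h^-1 *: y)).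
Proof.
move/convex_setP => cA; elim: s => [|v s IH] sA y h /=.
  by case=> -> ->; rewrite ltxx; do !split.
have vA := sA v (mem_head _ _).
have {}IH := IH (fun w ws => sA w (mem_behead (s := v :: s) ws)).
move=> [t t0 /IH[ht [yt hA]]].
have th : t <= h by rewrite -subr_ge0.
have h0 := le_trans t0 th; split=> //; split=> [h00|{}h0].
  have t00 : t = 0 by apply/eqP; rewrite eq_le t0 -h00 th.
  by move: yt; rewrite h00 t00 subr0 scale0r subr0; apply.
have [ht0|ht0] := eqVneq t h.
  have /yt/eqP : h - t = 0 by rewrite ht0 subrr.
  by rewrite subr_eq0 => /eqP ->; rewrite ht0 scalerA mulVf ?scale1r // gt_eqF.
have {}ht0 : 0 < h - t by rewrite subr_gt0 lt_neqAle ht0.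
have -> : h^-1 *: y = (t / h) *: v + (1 - t / h) *: ((h - t)^-1 *: (y - t *: v)).
  have -> : 1 - t / h = (h - t) / h by field; rewrite gt_eqF.
  rewrite scalerA mulrAC divff ?gt_eqF // mul1r scalerBr scalerA.
  by rewrite [_^-1 * t]mulrC addrCA subrr addr0.
apply: cA; [exact: vA|exact: hA|].
by rewrite divr_ge0 ?(ltW h0) //= ler_pdivrMr // mul1r.
Qed.

Lemma hullP s x : convex_hull [set` s] x <-> in_cone s x 1.
Proof.
split=> [|/(in_cone_convex (@convex_hull_convex [set` s]))]; last first.
  case=> [v vs|_ [_ /(_ ltr01)]]; last by rewrite invr1 scale1r.
  exact: sub_gen_smallest.
apply: (@convex_hull_min _ [set y | in_cone s y 1]) => [|v /= vs]; last exact: in_cone_mem.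
apply/convex_setP => {}x y t xs ys /andP[t0 t1].
have t1' : 0 <= 1 - t by rewrite subr_ge0.
have := in_coneD (in_coneZ t0 xs) (in_coneZ t1' ys).
by have -> : t * 1 + (1 - t) * 1 = 1 by ring.
Qed.

(** With [al], [be] the weights of v in y and z and [ga] their mean, (1 - ga) v is a combination of
    [s] of total weight 1 - ga. If ga < 1, v lies in the hull of [s]; otherwise both weights are 1
    and y = z = v. *)
Lemma sub_in_cone_head v s y z : in_cone (v :: s) y 1 -> in_cone (v :: s) z 1 ->
  forall t : R, 0 < t < 1 -> v = t *: y + (1 - t) *: z ->
  y = z \/ convex_hull [set` s] v.
Proof.
move=> /= [al al0 yal] [be be0 zbe] t /andP[t0 t1] vE.
have cs := @convex_hull_convex [set` s].
have sS : {in s, forall w, convex_hull [set` s] w} by move=> w ws; apply: sub_gen_smallest.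
have [al1 [yE _]] := in_cone_convex cs sS yal.
have [be1 [zE _]] := in_cone_convex cs sS zbe.
have t1' : 0 < 1 - t by rewrite subr_gt0.
have := in_coneD (in_coneZ (ltW t0) yal) (in_coneZ (ltW t1') zbe).
pose ga := t * al + (1 - t) * be.
have -> : t *: (y - al *: v) + (1 - t) *: (z - be *: v) = (1 - ga) *: v.
  rewrite !scalerBr addrACA -vE !scalerA -opprD -scalerDl -/ga.
  by rewrite scalerBl scale1r.
have -> : t * (1 - al) + (1 - t) * (1 - be) = 1 - ga by rewrite /ga; ring.
move/(in_cone_convex cs sS) => [ga1 [_ gaA]].
have [{}ga1|ga1'] := ltrP 0 (1 - ga).
  by right; have := gaA ga1; rewrite scalerA mulVf ?scale1r // gt_eqF.
left; have [ali bei] : 1 - al = 0 /\ 1 - be = 0.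
  have H1 : 0 <= t * (1 - al) by rewrite mulr_ge0 // ltW.
  have H2 : 0 <= (1 - t) * (1 - be) by rewrite mulr_ge0 // ltW.
  have H3 : t * (1 - al) + (1 - t) * (1 - be) = 1 - ga by rewrite /ga; ring.
  have /eqP : t * (1 - al) = 0 by lra.
  rewrite mulf_eq0 gt_eqF //= => /eqP ->.
  have /eqP : (1 - t) * (1 - be) = 0 by lra.
  by rewrite mulf_eq0 gt_eqF //= => /eqP ->.
have := yE ali; have := zE bei.
move/eqP: ali; rewrite subr_eq0 => /eqP <-; move/eqP: bei; rewrite subr_eq0 => /eqP <-.
by rewrite !scale1r => /eqP; rewrite subr_eq0 => /eqP -> /eqP; rewrite subr_eq0 => /eqP.
Qed.

(** Discard points lying in the hull of the others; by [sub_in_cone_head] an irredundant list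
    consists of vertices. *)
Lemma hull_vertices s : exists s', convex_hull [set` s] = convex_hull [set` s'] /\
  {in s', forall v, vertex (convex_hull [set` s]) v}.
Proof.
have [n] := ubnP (size s); elim: n s => // n IH s; rewrite ltnS => sn.
have [red|irr] := pselect (exists2 v, v \in s & convex_hull [set` rem v s] v).
  have [v vs vr] := red.
  have E : convex_hull [set` s] = convex_hull [set` rem v s].
    apply/seteqP; split; apply: convex_hull_min; try exact: convex_hull_convex.
      move=> w /=; rewrite (perm_mem (perm_to_rem vs)) inE => /predU1P[->//|].
      by move=> ws; apply: sub_gen_smallest.
    by move=> w /= /mem_rem ws; apply: sub_gen_smallest.
  rewrite E; apply: IH.
  by rewrite (leq_trans _ sn) // size_rem // ltn_predL; case: (s) vs.
exists s; split=> // v vs; split=> [|y z t yP zP t01 vE]; first exact: sub_gen_smallest.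
have consE : [set` s] = [set` v :: rem v s].
  by apply/seteqP; split=> w /=; rewrite (perm_mem (perm_to_rem vs)).
rewrite consE in yP zP.
have [//|vr] := sub_in_cone_head ((hullP _ _).1 yP) ((hullP _ _).1 zP) t01 vE.
by case: irr; exists v.
Qed.

(* Fourier-Motzkin elimination of the variable t. *)
Lemma eliminate (T : eqType) (L : seq T) (f g : T -> R) :
  (exists2 t, 0 <= t & {in L, forall i, t * f i <= g i}) <->
  {in L, forall i, 0 <= f i -> 0 <= g i} /\
  {in L &, forall p m, 0 < f p -> f m < 0 -> 0 <= f p * g m - f m * g p}.
Proof.
split=> [[t t0 tL]|[nonneg cross]].
  split=> [l lL fl|p m pL mL fp fm]; first exact: le_trans (mulr_ge0 t0 fl) (tL l lL).
  have := ler_wpM2l (ltW fp) (tL m mL); have := ler_wnM2l (ltW fm) (tL p pL).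
  by rewrite mulrCA; nra.
(* The witness is the largest of 0 and the lower bounds g i / f i with f i < 0; the last clause
   records where it is attained, for use with [cross]. *)
have [t [t0 tL tE]] : exists t, [/\ 0 <= t, {in L, forall i, f i < 0 -> t * f i <= g i} &
    t = 0 \/ exists2 m, m \in L & f m < 0 /\ t * f m = g m].
  elim: L {nonneg cross} => [|l L [t [t0 tL tE]]]; first by exists 0; split=> //; left.
  have tE' : t = 0 \/ exists2 m, m \in l :: L & f m < 0 /\ t * f m = g m.
    by case: tE => [->|[m mL mt]]; [left|right; exists m => //; rewrite inE mL orbT].
  have [fl|fl] := lerP 0 (f l).
    exists t; split=> // m; rewrite inE => /predU1P[->|/tL//].
    by rewrite ltNge fl.
  have [tl|tl] := lerP (t * f l) (g l).
    by exists t; split=> // m; rewrite inE => /predU1P[->|/tL].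
  exists (g l / f l).
  have tt : t < g l / f l by rewrite ltr_ndivlMr.
  split; first exact: le_trans t0 (ltW tt).
    move=> m; rewrite inE => /predU1P[->|mL fm]; first by rewrite divfK ?lt_eqF.
    by apply: le_trans (tL m mL fm); rewrite ler_wnM2r // ltW.
  by right; exists l; [exact: mem_head|rewrite divfK ?lt_eqF].
exists t => // l lL; have [/tL->//|fl|fl] := ltrgtP (f l) 0.
  case: tE => [->|[m mL [fm tm]]]; first by rewrite mul0r nonneg // ltW.
  have := cross l m lL mL fl fm; rewrite -tm => H.
  have : 0 <= f m * (t * f l - g l) by lra.
  by rewrite nmulr_rge0 // subr_le0.
by rewrite fl mulr0 nonneg // fl.
Qed.

(** Homogenisation of [ev], recovered at h = 1. *)
Definition hev l y (h : R) : R := dot l.1 y + l.2%:~R * h.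

Definition comb_form (b c : int) l l' : form :=
  (b *: l.1 + c *: l'.1, b * l.2 + c * l'.2).

Lemma hev_comb b c l l' y h :
  hev (comb_form b c l l') y h = b%:~R * hev l y h + c%:~R * hev l' y h.
Proof. by rewrite /hev dotDl !dotZl rmorphD !rmorphM /=; ring. Qed.

(** Weyl's theorem: the weight of each new generator is eliminated, and combining forms by their
    integer values keeps them integral. Without generators, each coordinate and its negative cut out
    the origin. *)
Lemma cone_forms (s : seq 'rV[int]_N) : exists L : seq form, forall y h,
  in_cone [seq pt a | a <- s] y h <-> {in L, forall l, 0 <= hev l y h}.
Proof.
elim: s => [|a s [L LP]] /=.
  pose e k : form := (delta_mx 0 k, 0); pose c : form := (0, 1).
  exists (c :: - c :: [seq e k | k <- enum 'I_N] ++ [seq - e k | k <- enum 'I_N]) => y h.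
  have hevN l : hev (- l) y h = - hev l y h by rewrite /hev dotNl mulrNz; ring.
  have hevc : hev c y h = h.
    by rewrite /hev /dot big1 ?add0r ?mul1r // => k _; rewrite mxE mul0r.
  have heve k : hev (e k) y h = y 0 k.
    rewrite /hev mul0r addr0 /dot (bigD1 k) //= mxE !eqxx mul1r big1 ?addr0 // => j jk.
    by rewrite mxE (negPf jk) andbF mul0r.
  split=> [[-> ->] l|yL]; first by rewrite /hev dotr0 mulr0 addr0.
  have mN m : 0 <= hev m y h -> 0 <= hev (- m) y h -> hev m y h = 0.
    by rewrite hevN; lra.
  split.
    apply/rowP => k; rewrite mxE -heve.
    have ek : e k \in [seq e k | k <- enum 'I_N] by rewrite map_f ?mem_enum.
    have nek : - e k \in [seq - e k | k <- enum 'I_N].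
      by apply: (map_f (fun k => - e k)); rewrite mem_enum.
    by apply: mN; apply: yL; rewrite !inE mem_cat ?ek ?nek ?orbT.
  by rewrite -hevc; apply: mN; apply: yL; rewrite !inE eqxx ?orbT.
(* The homogenised form at the new generator (a, 1). *)
pose val (l : form) : int := idot l.1 a + l.2.
have hevE l y h t : hev l (y - t *: pt a) (h - t) = hev l y h - t * (val l)%:~R.
  by rewrite /hev dotBr dotZr dot_intpt /val rmorphD /=; ring.
exists ([seq l <- L | 0 <= val l] ++
  [seq comb_form (val p) (- val m) m p | p <- [seq l <- L | 0 < val l],
                                         m <- [seq l <- L | val l < 0]]) => y h.
have := eliminate L (fun l => (val l)%:~R) (fun l => hev l y h) => elim.
apply: (@iff_trans _ (exists2 t, 0 <= t & {in L, forall l, t * (val l)%:~R <= hev l y h})).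
  by split=> -[t t0 tL]; exists t => // ; [move=> l lL|apply/LP => l lL];
    [move/LP: tL => /(_ l lL)|move: (tL l lL)]; rewrite hevE subr_ge0.
apply: (iff_trans elim); split=> [[nonneg cross] l|yL].
  rewrite mem_cat mem_filter => /orP[/andP[l0 lL]|/allpairsP[[p m] /=]].
    by apply: nonneg => //; rewrite ler0z.
  rewrite !mem_filter => -[/andP[p0 pL] /andP[m0 mL] ->].
  rewrite hev_comb mulrNz mulNr; apply: cross => //; first by rewrite ltr0z.
  by rewrite ltrz0.
split=> [l lL l0|p m pL mL p0 m0].
  by apply: yL; rewrite mem_cat mem_filter lL andbT -(ler0z R) l0.
have := yL (comb_form (val p) (- val m) m p).
rewrite hev_comb mulrNz mulNr; apply; rewrite mem_cat; apply/orP; right.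
apply/allpairsP; exists (p, m); split=> //=; rewrite mem_filter.
  by rewrite pL andbT -(ltr0z R).
by rewrite mL andbT -(ltrz0 R).
Qed.

Lemma polytope_forms P : integral_polytope P ->
  exists L : seq form, forall x, P x <-> {in L, forall l, 0 <= ev l x}.
Proof.
move=> [[s ->] intv]; have [s' [ss' s'v]] := hull_vertices s.
have [t s't] : exists t : seq 'rV[int]_N, s' = [seq pt a | a <- t].
  elim: s' s'v {ss'} => [|v s' IH] s'v; first by exists [::].
  have [w ws'|t ->] := IH; first by apply: s'v; rewrite inE ws' orbT.
  have [a ->] := intv v (s'v v (mem_head _ _)); by exists (a :: t).
have [L LP] := cone_forms t; exists L => x; rewrite ss' s't.
apply: (iff_trans (hullP _ _)); apply: (iff_trans (LP _ _)).
by split=> xL l /xL; rewrite /hev /ev mulr1.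
Qed.

End Polytopes.

(** * Affine hull, dimension, relative interior and tangent cones in terms of forms *)

Section Geometry.
Variables (R : realType) (N : nat).
Local Notation vec := 'rV[R]_N.
Local Notation form := (form N).
Local Notation pt a := (intpt R a).
Implicit Types (x y z w v : vec) (l : form) (E I J L : seq form) (a u : 'rV[int]_N).
Implicit Types (A P : set vec).

Definition closed_poly E J : set vec :=
  [set x | {in E, forall l, ev l x = 0} /\ {in J, forall l, 0 <= ev l x}].

Lemma closed_poly_convex E J x y (t : R) : closed_poly E J x -> closed_poly E J y ->
  0 <= t <= 1 -> closed_poly E J (t *: x + (1 - t) *: y).
Proof.
move=> [xE xJ] [yE yJ] /andP[t0 t1]; split=> l lL; rewrite ev_comb.
  by rewrite xE // yE // !mulr0 addr0.
by rewrite addr_ge0 // mulr_ge0 ?xJ ?yJ // subr_ge0.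
Qed.

(** Inequalities tight on all of [P] become equations; midpoints of witnesses for the others give a
    strictly feasible point. *)
Lemma split_equalities P L x1 : P x1 -> (forall x, P x <-> {in L, forall l, 0 <= ev l x}) ->
  exists E J x0, P = closed_poly E J /\ opn E J x0.
Proof.
have half : 0 <= (2^-1 : R) <= 1 by apply/andP; split; lra.
have mid (b c : R) : 0 <= b -> 0 <= c -> 0 < b + c -> 0 < 2^-1 * b + (1 - 2^-1) * c.
  by lra.
move=> x1P PL; pose tight l := `[< forall x, P x -> ev l x = 0 >].
pose E := [seq l <- L | tight l]; pose J := [seq l <- L | ~~ tight l].
have PE : P = closed_poly E J.
  apply/seteqP; split=> x; last first.
    move=> [xE xJ]; apply/PL => l lL; have [tl|tl] := boolP (tight l).
      by rewrite xE // mem_filter tl.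
    by apply: xJ; rewrite mem_filter tl.
  move=> xP; split=> l; rewrite mem_filter => /andP[].
    by move=> /asboolP tl _; apply: tl.
  by move=> _ lL; move/PL: xP; apply.
have [x0 x0P x0J] : exists2 x0, P x0 & {in J, forall l, 0 < ev l x0}.
  have : {subset J <= J} by [].
  elim: {1 3}J => [|l M IH] MJ; first by exists x1.
  have [m mM|x0 x0P x0M] := IH; first by apply: MJ; rewrite inE mM orbT.
  have lJ := MJ l (mem_head _ _).
  have [y yP ly] : exists2 y, P y & 0 < ev l y.
    move: lJ; rewrite mem_filter => /andP[/asboolP/existsNP[y /not_implyP[yP ly]] lL].
    exists y => //; rewrite lt_neqAle eq_sym.
    by move/PL: (yP) => /(_ l lL) ->; rewrite andbT; apply/eqP.
  exists (2^-1 *: x0 + (1 - 2^-1) *: y).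
    by rewrite PE in x0P yP *; apply: closed_poly_convex.
  move: (x0P) (yP); rewrite PE => -[_ x0J] [_ yJ].
  move=> m; rewrite ev_comb inE => mlM.
  have mJ : m \in J by apply: MJ; rewrite inE.
  apply: mid; [exact: x0J|exact: yJ|].
  case/predU1P: mlM => [->|mM]; first by rewrite ltr_wpDl // x0J.
  by rewrite ltr_wpDr // ?yJ // x0M.
exists E, J, x0; split=> //; apply/opnP; split=> //.
by move: x0P; rewrite PE => -[].
Qed.

Section Poly.
Variables (E J : seq form) (x0 : vec).
Hypothesis x0J : opn E J x0.
Let P := closed_poly E J.

(** Any solution x of the equations lies on the line through x0 and a point of [P] near x0 in the
    direction of x. *)
Lemma affine_hull_poly : affine_hull P = [set x | {in E, forall l, ev l x = 0}].
Proof.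
have /opnP[x0E x0J'] := x0J.
apply/seteqP; split=> x.
  apply: smallest_sub => [y z t yE zE l lE|y []//].
  by rewrite ev_comb yE // zE // !mulr0 addr0.
move=> xE B [aB PB]; have [e e0 eJ] := small_step_lt (x - x0) x0J'.
have yB : B (x0 + e *: (x - x0)).
  apply: PB; split=> l lL; last exact/ltW/eJ.
  by rewrite ev_move xE // x0E // !mulr0 addr0.
have x0B : B x0 by apply: PB; split=> // l lJ; exact/ltW/x0J'.
have -> : x = e^-1 *: (x0 + e *: (x - x0)) + (1 - e^-1) *: x0.
  rewrite scalerDr scalerA mulVf ?gt_eqF // scale1r scalerBl scale1r.
  by rewrite addrC addrA subrK addrC subrK.
exact: aB.
Qed.

(** The direction space is the kernel of [lspan E] extended to the reals, and field extension
    preserves rank. *)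
Lemma rank_dim d : has_dim P d -> (\rank (lspan E) + d)%N = N.
Proof.
move=> [x1 [U [<- ]]] {d}; rewrite affine_hull_poly => hE.
have /opnP[x0E _] := x0J.
have inU y : (y <= U)%MS <-> {in E, forall l, dot l.1 y = 0}.
  have x1E : {in E, forall l, ev l x1 = 0}.
    by move: hE => /seteqP[_ /(_ x1)]; apply; rewrite /= subrr sub0mx.
  have := congr1 (fun S : set vec => S (x1 + y)) hE.
  rewrite /= [x1 + y]addrC addrK => <-.
  by split=> yE l lE; have := yE l lE; rewrite addrC evD x1E // add0r.
pose M : 'M[R]_N := map_mx ratr (lspan E).
have kerM y : (y <= kermx M^T)%MS <-> {in E, forall l, dot l.1 y = 0}.
  have dotE (c : 'rV[rat]_N) : (y *m (map_mx ratr c)^T) 0 0 = rdot c y.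
    by rewrite mxE; apply: eq_bigr => k _; rewrite !mxE mulrC.
  split=> [/sub_kermxP yM l lE|yE].
    have /submxP[D lD] := mem_lspan lE.
    by rewrite -rdot_rowq -dotE lD map_mxM trmx_mul mulmxA -/M yM mul0mx mxE.
  apply/sub_kermxP/rowP => k; rewrite [RHS]mxE.
  rewrite -(lspan_rdot0 (row_sub k (lspan E)) yE) -dotE map_row -/M.
  by rewrite !mxE; apply: eq_bigr => i _; rewrite !mxE.
have -> : \rank U = \rank (kermx M^T).
  apply/eqmx_rank/andP; split; apply/row_subP => i.
    by apply/kerM/inU; exact: row_sub.
  by apply/inU/kerM; exact: row_sub.
by rewrite mxrank_ker mxrank_tr mxrank_map subnKC // rank_leq_row.
Qed.

(** From a relative interior point x one can move slightly away from x0 inside [P], so no inequality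
    of [J] is tight at x; conversely, strict inequalities persist on a ball. *)
Lemma relint_poly : relint P = [set x | opn E J x].
Proof.
have /opnP[x0E x0J'] := x0J.
rewrite /relint affine_hull_poly; apply/seteqP; split=> x /=.
  rewrite /within /= => -[xE xP].
  have [_ xJ] : P x by exact: (nbhs_singleton xP).
  have /nbhs_ballP[e /= e0 eP] := xP.
  pose D := \sum_k `|(x - x0) 0 k|.
  have D0 : 0 <= D by rewrite sumr_ge0.
  (* Every coordinate moves by at most t D <= e / 2; the 1 avoids division by 0. *)
  pose t := e / (2 * (1 + D)).
  have t0 : 0 < t by rewrite divr_gt0 // mulr_gt0 // ltr_pwDl.
  have yP : P (x + t *: (x - x0)).
    apply: eP => [|l lE]; last by rewrite evD dotZr -evB xE // x0E // subrr mulr0 addr0.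
    split=> // i k; rewrite ord1 !mxE /ball /= opprD addrA subrr sub0r normrN.
    rewrite normrM gtr0_norm //.
    have kD : `|x 0 k - x0 0 k| <= D.
      by rewrite /D (bigD1 k) //= !mxE lerDl sumr_ge0.
    have tD : t * (1 + D) = e / 2 by rewrite /t; field; lra.
    have : t * `|x 0 k - x0 0 k| <= t * D by rewrite ler_wpM2l // ltW.
    by lra.
  apply/opnP; split=> // l lJ; rewrite lt_neqAle xJ // andbT eq_sym; apply/eqP => lx.
  have [_ /(_ l lJ)] := yP; rewrite evD dotZr -evB lx add0r sub0r mulrN oppr_ge0.
  by rewrite leNgt mulr_gt0 // x0J'.
move=> /opnP[xE xJ]; split=> //; rewrite /within /=.
have [e e0 eJ] : exists2 e, 0 < e & forall z, (forall k, `|x 0 k - z 0 k| < e) ->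
    {in J, forall l, 0 <= ev l z}.
  elim: J xJ => [|l L IH] xL; first by exists 1.
  have [m mL|e e0 eL] := IH; first by apply: xL; rewrite inE mL orbT.
  pose D := \sum_k `|(l.1 0 k)%:~R : R|.
  have D0 : 0 <= D by rewrite sumr_ge0.
  have lx := xL l (mem_head _ _).
  exists (Num.min e (ev l x / (1 + D))).
    by rewrite lt_min e0 divr_gt0 // ltr_pwDl.
  move=> z xz m; rewrite inE => /predU1P[->|mL]; last first.
    by apply: eL mL => k; have := xz k; rewrite lt_min => /andP[].
  have -> : ev l z = ev l x - dot l.1 (x - z) by rewrite -evB; ring.
  have : dot l.1 (x - z) <= D * (ev l x / (1 + D)).
    rewrite /dot /D big_distrl /=; apply: ler_sum => k _.
    apply: le_trans (ler_norm _) _; rewrite normrM ler_wpM2l // !mxE.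
    by have := xz k; rewrite lt_min => /andP[_ /ltW].
  have DD : D * (ev l x / (1 + D)) <= ev l x.
    rewrite mulrCA ger_pMr // ler_pdivrMr ?mul1r ?ltr_pwDl //; lra.
  lra.
apply/nbhs_ballP; exists e => //= z [_ xz] zE; split=> //.
by apply: eJ => k; exact: xz.
Qed.

(** If y respects the active inequalities, v + e y stays in [P] for small e, and y is e^-1 times
    this displacement. *)
Lemma tangent_cone_poly v : P v ->
  tangent_cone P v = [set y | {in E, forall l, dot l.1 y = 0} /\
                              {in J, forall l, ev l v = 0 -> 0 <= dot l.1 y}].
Proof.
move=> [vE vJ]; apply/seteqP; split=> y.
  move=> [r [x [r0 [xE xJ] ->]]]; split=> l lL; rewrite dotZr -evB.
    by rewrite xE // vE // subrr mulr0.
  by move=> ->; rewrite subr0 mulr_ge0 // xJ.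
move=> [yE yJ]; have [|e e0 eJ] := @small_step R N J v y.
  by move=> l lJ; split; [exact: vJ|exact: yJ].
exists e^-1, (v + e *: y); split; first by rewrite invr_ge0 ltW.
  split=> l lL; last by apply: eJ => //; rewrite lexx ltW.
  by rewrite evD dotZr yE // vE // mulr0 addr0.
by rewrite addrAC subrr add0r scalerA mulVf ?scale1r // gt_eqF.
Qed.

(** A non-vertex lies inside a segment of [P] with distinct ends; an active form is nonnegative at
    both ends and 0 in between, so it kills their difference. *)
Lemma rank_active w : P w -> ~ vertex P w -> (\rank (lspan (E ++ active w J)) < N)%N.
Proof.
move=> [wE wJ] nv.
have [x [y [t [xP yP t01 wxy xy]]]] : exists x y t,
    [/\ P x, P y, 0 < t < 1, w = t *: x + (1 - t) *: y & x != y].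
  apply: contrapT => H; apply: nv; split=> // x y t xP yP t01 wxy.
  by apply/eqP/negPn/negP => xy; apply: H; exists x, y, t.
move: xP yP => [xE xJ] [yE yJ]; have /andP[t0 t1] := t01.
apply: (@real_kernel R N _ (x - y)); first by rewrite subr_eq0.
move=> l; rewrite mem_cat -evB => /orP[lE|]; first by rewrite xE // yE // subrr.
rewrite mem_filter => /andP[/eqP + lJ]; rewrite wxy ev_comb => lw.
have H1 : 0 <= t * ev l x by rewrite mulr_ge0 ?xJ // ltW.
have H2 : 0 <= (1 - t) * ev l y by rewrite mulr_ge0 ?yJ // subr_ge0 ltW.
have /eqP : t * ev l x = 0 by clear wxy; lra.
have /eqP : (1 - t) * ev l y = 0 by clear wxy; lra.
have t1' : 0 < 1 - t by rewrite subr_gt0.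
rewrite !mulf_eq0 (gt_eqF t0) (gt_eqF t1') /= => /eqP -> /eqP ->.
by rewrite subrr.
Qed.

End Poly.
End Geometry.

(** * Factors of the Ehrhart polynomial at negative q-integers *)

Lemma qint_factor (F : fieldType) (z p : F) : z != 1 ->
  1 + z * ((1 - p) / (1 - z)) - (1 - p) / (1 - z) = p.
Proof.
move=> z1; have z0 : 1 - z != 0 by rewrite subr_eq0 eq_sym.
by field.
Qed.

Lemma qvar_neq1 N (k : 'I_N) : qvar k != 1.
Proof.
apply/eqP => q1; have /monom_eq1/rowP/(_ k) : monom (@qvar N) (delta_mx 0 k) = 1.
  rewrite /monom (bigD1 k) //= mxE !eqxx /= expr1z q1 mul1r big1 // => j jk.
  by rewrite mxE (negPf jk) andbF expr0z.
by rewrite !mxE !eqxx.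
Qed.

Lemma monom_qint (N n : nat) (v : 'rV[int]_N) : (forall k, 0 <= v 0 k) ->
  \prod_k (1 + qvar k * qint (qvar k) (- n%:Z) - qint (qvar k) (- n%:Z)) ^+ absz (v 0 k) =
  monom (@qvar N) (- (n%:Z *: v)).
Proof.
move=> v0; apply: eq_bigr => k _; rewrite /qint qint_factor ?qvar_neq1 // !mxE.
by rewrite -{2}(gez0_abs (v0 k)) -mulNr -exprz_exp.
Qed.

(** * Passage from P to -nP and the reciprocity theorem *)

Section Final.
Variables (R : realType) (N n : nat).
Hypothesis n_gt0 : (0 < n)%N.
Local Notation vec := 'rV[R]_N.
Local Notation form := (form N).
Local Notation pt a := (intpt R a).
Local Notation q := (@qvar N).
Local Notation phi := (rat_ratfun N).
Local Notation q0 := (@qvar_neq0 N).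
Local Notation q1 := (@monom_eq1 N).
Implicit Types (x y z w v : vec) (l : form) (E I J L : seq form) (a b u : 'rV[int]_N).

Let nR0 : 0 < n%:R :> R. Proof. by rewrite ltr0n. Qed.

(** Turns forms describing P into forms describing -nP; the factor n keeps them integral. *)
Definition neg_dilate l : form := (- l.1, n%:Z * l.2).

Lemma ev_neg_dilate l y : ev (neg_dilate l) (- (n%:R *: y)) = n%:R * ev l y.
Proof. by rewrite /ev dotNl dotNr dotZr opprK rmorphM mulrDr. Qed.

Lemma neg_dilateK w : w = - (n%:R *: (- (n%:R^-1 *: w))).
Proof. by rewrite scalerN opprK scalerA divff ?scale1r // gt_eqF. Qed.

Lemma intpt_scale b : pt (n%:Z *: b) = n%:R *: pt b.
Proof. by apply/rowP => k; rewrite !mxE rmorphM. Qed.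

Lemma rank_neg_dilate L : \rank (lspan [seq neg_dilate l | l <- L]) = \rank (lspan L).
Proof.
have rowN (c : 'rV[int]_N) : rowq (- c) = - rowq c by exact: map_mxN.
apply/eqmx_rank/andP; split; apply/lspan_subP => l.
  by case/mapP => m mL ->; rewrite rowN eqmx_opp mem_lspan.
by move=> lL; rewrite -(eqmx_opp (rowq _)) -rowN; exact: (mem_lspan (map_f neg_dilate lL)).
Qed.

Section Poly.
Variables (E J : seq form) (x0 : vec).
Hypothesis x0J : opn E J x0.
Let P : set vec := closed_poly E J.
Let E' := [seq neg_dilate l | l <- E].
Let J' := [seq neg_dilate l | l <- J].

Lemma opn_neg_dilate y : opn E' J' (- (n%:R *: y)) = opn E J y.
Proof.
rewrite /opn !all_map; congr (_ && _); apply: eq_all => l /=; rewrite ev_neg_dilate.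
  by rewrite mulf_eq0 gt_eqF.
by rewrite pmulr_rgt0.
Qed.

Lemma closed_neg_dilate y :
  all (fun l => ev l (- (n%:R *: y)) == 0) E' &&
  all (fun l => 0 <= ev l (- (n%:R *: y))) J' <-> P y.
Proof.
rewrite !all_map; split=> [/andP[/allP yE /allP yJ]|[yE yJ]].
  split=> l lL.
    by have := yE l lL; rewrite /= ev_neg_dilate mulf_eq0 gt_eqF //= => /eqP.
  by have := yJ l lL; rewrite /= ev_neg_dilate pmulr_rge0.
apply/andP; split; apply/allP => l lL /=; rewrite ev_neg_dilate.
  by rewrite yE // mulr0.
by rewrite mulr_ge0 ?yJ // ltW.
Qed.

Lemma active_neg_dilate y :
  active (- (n%:R *: y)) J' = [seq neg_dilate l | l <- active y J].
Proof.
rewrite /active filter_map; congr map; apply: eq_filter => l /=.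
by rewrite ev_neg_dilate mulf_eq0 gt_eqF.
Qed.

(** Dilation by -n reverses tangent cones, so the opposite cone of -nP at -nb is the tangent cone of
    P at b translated by -nb. *)
Lemma opp_cone_tangent b a : P (pt b) ->
  opp_cone (- (n%:R *: pt b)) E' J' (pt a) =
  (pt (a + n%:Z *: b) \in tangent_cone P (pt b)).
Proof.
move=> bP; rewrite (tangent_cone_poly bP).
have /andP[bE bJ] := (closed_neg_dilate (pt b)).2 bP.
rewrite opp_cone_mixed // active_neg_dilate.
have evE l : ev l (pt b) = 0 ->
    ev (neg_dilate l) (pt a) = - dot l.1 (pt (a + n%:Z *: b)).
  move=> lb; have -> : pt a = - (n%:R *: pt b) + pt (a + n%:Z *: b).
    by rewrite intptD intpt_scale addrCA addNr addr0.
  by rewrite evD ev_neg_dilate lb mulr0 add0r dotNl.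
have {bE bJ} [bE bJ] := bP.
apply/idP/idP => [/andP[/andP[/allP aE _] /allP aJ]|].
  apply/mem_set; split=> l lL.
    by have := aE _ (map_f neg_dilate lL); rewrite evE ?bE // oppr_eq0 => /eqP.
  move=> lb; rewrite -oppr_le0 -evE //; apply/aJ/map_f.
  by rewrite mem_filter lb eqxx.
move=> /set_mem[aE aJ]; apply/andP; split; last first.
  apply/allP => _ /mapP[l + ->]; rewrite mem_filter => /andP[/eqP lb lJ].
  by rewrite evE // oppr_le0 aJ.
rewrite /opn /= andbT; apply/allP => _ /mapP[l lE ->].
by rewrite evE ?bE // aE // oppr0.
Qed.

(** Translating to the origin shows that the tangent cone has a value, hence [sigma_cone] is one;
    translating back gives the summand of the Ehrhart polynomial at b. *)
Lemma rep_vertex b : P (pt b) ->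
  rep q (fun a => (opp_cone (- (n%:R *: pt b)) E' J' (pt a))%:R)
    (monom q (- (n%:Z *: b)) * sigma_cone (tangent_cone P (pt b))).
Proof.
move=> bP; have [f fP] := rep_opp_cone phi q0 q1 (- (n%:R *: pt b)) E' J'.
have : rep q (fun a => (pt a \in tangent_cone P (pt b))%:R)
             (monom q (n%:Z *: b) * f).
  apply: eq_rep (rep_shift phi q0 _ fP) => a.
  by rewrite opp_cone_tangent // subrK.
move/rep_sigma_cone/(rep_shift phi q0 (- (n%:Z *: b))); apply: eq_rep => a.
by rewrite opp_cone_tangent // opprK.
Qed.

Lemma rep_nonvertex w : ~ vertex P (- (n%:R^-1 *: w)) ->
  rep q (fun a => (opp_cone w E' J' (pt a))%:R) 0.
Proof.
rewrite {2}(neg_dilateK w); set y := - _ => yv.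
have [yP|yP] := pselect (P y).
  apply: (rep_opp_cone0 phi q0 q1).
  rewrite active_neg_dilate -map_cat rank_neg_dilate.
  exact: rank_active yP yv.
apply: (rep_false phi) => a; apply/negP => /and4P[yE yJ _ _]; apply: yP.
by apply/closed_neg_dilate; rewrite yE.
Qed.

(** [reciprocalP] is applied to -nP with a list containing the images of [Vs]. All other points come
    from non-vertices and contribute 0, and uniqueness of values gives the equality. *)
Lemma reciprocity_sum (Vs T : seq 'rV[int]_N) d : has_dim P d ->
  uniq Vs -> uniq T -> (forall y, vertex P y -> exists2 b, b \in Vs & y = pt b) ->
  {in Vs, forall b, P (pt b)} ->
  (forall b, (b \in T) = opn E J (n%:R^-1 *: pt b)) ->
  \sum_(b <- Vs) monom q (- (n%:Z *: b)) * sigma_cone (tangent_cone P (pt b)) =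
  (-1) ^+ d * \sum_(a <- T) monom (fun k => (q k)^-1) a.
Proof.
move=> dimP uV uT Vvert VP TP.
have [|W0 W0P] := @reciprocalP R N _ phi _ q0 q1 E' J'.
  by exists (- (n%:R *: x0)); rewrite opn_neg_dilate.
pose Vw := [seq - (n%:R *: pt b) | b <- Vs].
pose W := undup (Vw ++ W0).
have subW : {subset W0 <= W} by move=> w wW; rewrite mem_undup mem_cat wW orbT.
have total := W0P W (undup_uniq _) subW.
have uVw : uniq Vw.
  rewrite map_inj_in_uniq // => b c _ _ /oppr_inj /(scalerI _) bc.
  by apply: (@intpt_inj R N); apply: bc; rewrite gt_eqF.
have repV : rep q (fun a => \sum_(w <- W | w \in Vw) (opp_cone w E' J' (pt a))%:R)
    (\sum_(b <- Vs) monom q (- (n%:Z *: b)) * sigma_cone (tangent_cone P (pt b))).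
  have Wperm : perm_eq [seq w <- W | w \in Vw] Vw.
    apply: uniq_perm => [||w]; [by rewrite filter_uniq // undup_uniq|by []|].
    by rewrite mem_filter mem_undup mem_cat; case: (w \in Vw).
  have := rep_sum phi q0 Vs (P := mem Vs) (fun b bV => rep_vertex (VP b bV)).
  rewrite -big_seq; apply: eq_rep => a.
  by rewrite -[RHS]big_filter (perm_big _ Wperm) big_map -big_seq.
have repW : rep q (fun a => \sum_(w <- W | w \notin Vw) (opp_cone w E' J' (pt a))%:R) 0.
  have nv w : w \notin Vw -> rep q (fun a => (opp_cone w E' J' (pt a))%:R) 0.
    move=> wV; apply: rep_nonvertex => /Vvert[b bV yb]; case/negP: wV.
    by apply/mapP; exists b => //; rewrite -yb -neg_dilateK.
  by have := rep_sum phi q0 W nv; rewrite big1.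
(* The integer points of the relative interior of -nP are the negatives of [T], whence the inverted
   variables. *)
have repT : rep q (fun a => (opn E' J' (pt a))%:R)
    (\sum_(a <- T) monom (fun k => (q k)^-1) a).
  have := rep_sum phi q0 T (P := xpredT) (fun b _ => rep_monom phi q (- b)).
  rewrite (eq_bigr (fun b => monom (fun k => (q k)^-1) b)) => [|b _]; last first.
    by rewrite -monomN.
  apply: eq_rep => a; under eq_bigr => b _ do rewrite -eqr_oppLR eq_sym.
  have -> : opn E' J' (pt a) = (- a \in T).
    by rewrite TP intptN scalerN -opn_neg_dilate -neg_dilateK.
  have [aT|aT] := boolP (- a \in T).
    rewrite (bigD1_seq (- a)) //= eqxx big1 ?addr0 // => b /negPf.
    by move=> ->.
  rewrite big_seq big1 // => b bT; case: eqP => // ba.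
  by rewrite -ba bT in aT.
(* The rank of [E] is N - d, so N plus this rank has the parity of d. *)
have signE : (-1) ^+ (N + \rank (lspan E')) = (-1) ^+ d :> rat.
  rewrite rank_neg_dilate -{1}(rank_dim x0J dimP) addnAC addnn -mul2n.
  by rewrite exprD exprM sqrrN expr1n mul1r.
have := repB phi q0 (repD phi q0 repV repW) (repZ phi q0 ((-1) ^+ d) repT).
have {}total : rep q (fun a => \sum_(w <- W | w \in Vw) (opp_cone w E' J' (pt a))%:R +
    \sum_(w <- W | w \notin Vw) (opp_cone w E' J' (pt a))%:R -
    (-1) ^+ d * (opn E' J' (pt a))%:R) 0.
  by apply: eq_rep total => a; rewrite signE (bigID (mem Vw)).
move/(rep_uniq phi q0 total)/esym/eqP; rewrite addr0 subr_eq0 => /eqP ->.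
by rewrite -(fmorph_eq_rat phi) rmorphXn rmorphN1.
Qed.

End Poly.
End Final.

Theorem theorem3p3 (R : realType) (N d : nat) (P : set 'rV[R]_N)
  (hP : integral_polytope P)
  (hpos : forall x : 'rV[R]_N, P x -> forall k : 'I_N, (0 <= x 0 k)%R)
  (hd : has_dim P d)
  (n : nat) (hn : (0 < n)%N) :
  ((multibasic_ehrhart P).@[fun k : 'I_N => qint (qvar k) (- n%:Z)] =
   (-1) ^+ d *
   sigma_bounded (dilate n%:R (relint P)) (fun k : 'I_N => (qvar k)^-1))%R.
Proof.
(* The affine hull of the empty set is empty, whereas [has_dim] puts a point in it. *)
have [x1 x1P] : exists x, P x.
  apply: contrapT => P0; case: hd => x [U [_ hE]].
  have : affine_hull P x by rewrite hE /= subrr sub0mx.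
  apply: (@smallest_sub _ _ _ set0) => [y z t //|y yP].
  by apply: P0; exists y.
have [L PL] := polytope_forms hP.
have [E [J [x0 [PE x0J]]]] := split_equalities x1P PL.
have [[s Ps] intv] := hP.
(* Sums over sets become sums over lists only for finite sets; here finiteness comes from bounded
   coordinates. *)
have finpt (S : set 'rV[int]_N) (m : nat) :
    (forall b, S b -> forall k, 0 <= b 0 k <= m%:Z) -> finite_set S.
  move=> Sm; pose f (g : {ffun 'I_N -> 'I_m.+1}) : 'rV[int]_N := \row_k (g k)%:Z.
  apply: (@sub_finite_set _ _ (f @` setT)); last first.
    by apply: finite_image; exact: finite_finset.
  move=> b bS; exists [ffun k => inord (absz (b 0 k))] => //.
  apply/rowP => k; rewrite mxE ffunE; have /andP[b0 bm] := Sm b bS k.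
  by rewrite inordK ?gez0_abs // ltnS -lez_nat gez0_abs.
have [m Pm] : exists m : nat, forall x : 'rV[R]_N, P x -> forall k, x 0 k <= m%:R.
  have [m sm] : exists m : nat, {in s, forall (x : 'rV[R]_N) k, x 0 k <= m%:R}.
    elim: (s) => [|v r [m rm]]; first by exists 0%N.
    pose S := \sum_k `|v 0 k|; have S0 : 0 <= S by rewrite sumr_ge0.
    exists (m + Num.bound S)%N => x; rewrite inE natrD => /predU1P[->|xr] k.
      apply: le_trans (_ : S <= _); last first.
        by rewrite (le_trans (ltW (archi_boundP S0))) // lerDr.
      by apply: le_trans (ler_norm _) _; rewrite /S (bigD1 k) //= lerDl sumr_ge0.
    by rewrite (le_trans (rm x xr k)) // lerDl.
  exists m => x; rewrite Ps.
  apply: (@convex_hull_min _ _ _ [set x : 'rV[R]_N | forall k, x 0 k <= m%:R]) => //.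
  apply/convex_setP => y z t ym zm /andP[t0 t1] k; rewrite !mxE.
  have := ler_wpM2l t0 (ym k); have : 0 <= 1 - t by rewrite subr_ge0.
  by move=> /ler_wpM2l/(_ _ _ (zm k)); lra.
have Pint (v : 'rV[int]_N) : P (intpt R v) -> forall k, 0 <= v 0 k.
  by move=> vP k; have := hpos _ vP k; rewrite mxE ler0z.
pose V := [set v : 'rV[int]_N | vertex P (intpt R v)].
have finV : finite_set V.
  apply: (finpt _ m) => v [vP _] k; rewrite Pint //=.
  by have := Pm _ vP k; rewrite mxE -(ler_int R).
pose S := [set a : 'rV[int]_N | dilate n%:R (relint P) (intpt R a)].
have SE b : S b <-> opn E J (n%:R^-1 *: intpt R b).
  have n0 : n%:R != 0 :> R by rewrite pnatr_eq0 -lt0n.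
  rewrite /S /= /dilate PE (relint_poly x0J); split=> [[y /= yJ <-]|bJ].
    by rewrite scalerA mulVf // scale1r.
  by exists (n%:R^-1 *: intpt R b); rewrite // scalerA divff // scale1r.
have finS : finite_set S.
  apply: (finpt _ (n * m)%N) => b /SE/opnP[bE bJ] k.
  have bP : P (n%:R^-1 *: intpt R b) by rewrite PE; split=> // l lJ; exact/ltW/bJ.
  have nR : 0 < n%:R :> R by rewrite ltr0n.
  have := hpos _ bP k; have := Pm _ bP k.
  rewrite !mxE mulrC ler_pdivrMr // pmulr_lge0 ?invr_gt0 // ler0z => bm ->.
  by rewrite -(ler_int R) PoszM intrM mulrC.
have Vuniq := fset_uniq (fset_set V); have Suniq := fset_uniq (fset_set S).
have main := @reciprocity_sum R N n hn E J x0 x0J (fset_set V) (fset_set S) d.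
rewrite -PE in main; rewrite /sigma_bounded fsbig_finite // -main //; last 3 first.
- move=> y yV; have [a ya] := intv y yV; exists a => //.
  by rewrite in_fset_set // mem_set // /V /= -ya.
- by move=> b; rewrite in_fset_set // => /set_mem[].
- move=> b; rewrite in_fset_set //; apply/idP/idP => [/set_mem/SE//|bJ].
  exact/mem_set/SE.
rewrite /multibasic_ehrhart fsbig_finite // raddf_sum [LHS]big_seq [RHS]big_seq.
apply: eq_bigr => v; rewrite in_fset_set // => /set_mem[vP _].
rewrite /= mevalZ rmorph_prod mulrC -(monom_qint _ (Pint v vP)); congr (_ * _).
apply: eq_bigr => k _; rewrite rmorphXn; congr (_ ^+ _).
by rewrite /= mevalB mevalD meval1 mevalZ mevalXU.
Qed.
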